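(* The Maximum Strong Transitivity Problem (MSTP) can be solved in linear time for trees. That is, MSTP restricted to input graphs $T=(V,E)$ that are trees is solvable by an algorithm with running time $O(|V|+|E|)$.
   Context: All graphs are finite, simple and undirected; $\deg_G(x)$ is the degree of $x$ in $G$. For disjoint $A,B\subseteq V$, $A$ strongly dominates $B$ if for every $y\in B$ there is $x\in A$ with $xy\in E$ and $\deg_G(x)\ge \deg_G(y)$. A strong transitive partition of $G$ of order (size) $k$ is a partition $\{V_1,V_2,\ldots,V_k\}$ of $V$ into nonempty (ordered) parts such that $V_i$ strongly dominates $V_j$ for all $1\le i<j\le k$. The strong transitivity $Tr_{st}(G)$ is the maximum order of a strong transitive partition of $G$. MSTP is the optimization problem whose instance is a graph $G$, whose feasible solutions are the strong transitive partitions of $G$, and whose measure, to be maximized, is the order of the partition (so that the optimum value is $Tr_{st}(G)$). *)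

(* Defs.v *)
From mathcomp Require Import all_boot.

Set Implicit Arguments.
Unset Strict Implicit.
Unset Printing Implicit Defensive.

(** * Graphs and strong transitive partitions *)

Section Graphs.
Variables (V : finType) (e : rel V).

Definition simple_graph : Prop := symmetric e /\ irreflexive e.

Definition edges : {set {set V}} :=
  [set [set u.1; u.2] | u in [pred u : V * V | e u.1 u.2]].

Definition deg (x : V) : nat := #|[set y | e x y]|.

(* A one-edge walk back and forth is a [ucycle] of size 2, so the cycles of a
   simple graph are exactly the [ucycle]s of size at least 3. *)
Definition tree : Prop :=
  [/\ 0 < #|V|,
      forall x y : V, connect e x y
    & forall c : seq V, ucycle e c -> size c < 3].

Definition strongly_dominates (A B : {set V}) : bool :=
  [forall y in B, exists x in A, e x y && (deg y <= deg x)].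

(* [P] lists the parts in order; the part of (1-based) index i is the entry
   of [P] at position i - 1. *)
Definition strong_transitive_partition (P : seq {set V}) : bool :=
  [&& uniq P, partition [set:: P] [set: V] & pairwise strongly_dominates P].

(* Nonempty disjoint parts number at most [#|V|], so the range of the maximum
   excludes no partition; see [strong_transitivity_max]. *)
Definition strong_transitivity : nat :=
  \max_(k < #|V|.+1 |
      [exists P : k.-tuple {set V}, strong_transitive_partition P]) k.

Lemma strong_transitivity_max (P : seq {set V}) :
  strong_transitive_partition P -> size P <= strong_transitivity.
Proof.
move=> stP; have /and3P[uP pP _] := stP.
have szP : size P < #|V|.+1.
  have sz : size P = #|[set:: P]| by rewrite cardsE (card_uniqP uP).
  rewrite ltnS sz -cardsT (card_partition pP) -sum1_card.
  apply: leq_sum => A PA; rewrite card_gt0.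
  by apply: contraTneq PA => ->; case/and3P: pP.
apply: (@leq_bigmax_cond _ _ (fun k : 'I_#|V|.+1 => k : nat) (Ordinal szP)).
by apply/existsP; exists (in_tuple P).
Qed.

Definition adjacency_lists (adj : V -> seq V) : Prop :=
  forall x : V, uniq (adj x) /\ (forall y : V, (y \in adj x) = e x y).

End Graphs.

(** * Word RAM

    Structured programs over scalar registers and an addressable memory, both
    holding natural numbers. Every node of an evaluated expression and every
    executed test or command other than [Seq] costs one time unit, so a program
    compiles to ordinary RAM code with constant overhead. Register numbers are
    part of the program text, so a program has finitely many registers;
    indirect addressing is through [Mem] and [Store] only. *)

Inductive expr : Type :=
| Lit of nat
| Reg of nat
| Mem of expr
| Plus of expr & expr
| Minus of expr & expr.

Inductive cmd : Type :=
| Skip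
| Assign of nat & expr
| Store of expr & expr
| Seq of cmd & cmd
| If of expr & cmd & cmd
| While of expr & cmd.

Record state : Type := State { regs : nat -> nat; memory : nat -> nat }.

Fixpoint cost (a : expr) : nat :=
  match a with
  | Lit _ | Reg _ => 1
  | Mem a1 => (cost a1).+1
  | Plus a1 a2 | Minus a1 a2 => (cost a1 + cost a2).+1
  end.

(* Words hold the values below [W]; a computation producing a larger value is
   stuck, there is no wrap-around. Subtraction is truncated at 0. *)
Definition word (W v : nat) : option nat := if v < W then Some v else None.

Fixpoint eval (W : nat) (s : state) (a : expr) : option nat :=
  match a with
  | Lit v => word W v
  | Reg r => Some (regs s r)
  | Mem a1 => omap (memory s) (eval W s a1)
  | Plus a1 a2 =>
      if (eval W s a1, eval W s a2) is (Some v1, Some v2)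
      then word W (v1 + v2) else None
  | Minus a1 a2 =>
      if (eval W s a1, eval W s a2) is (Some v1, Some v2)
      then Some (v1 - v2) else None
  end.

(* [exec W p s t s']: run from [s] with words below [W], [p] halts in [s']
   after [t] time units. Tests succeed on nonzero values. *)
Inductive exec (W : nat) : cmd -> state -> nat -> state -> Prop :=
| ExecSkip s : exec W Skip s 1 s
| ExecAssign r a s v :
    eval W s a = Some v ->
    exec W (Assign r a) s (cost a).+1
      (State [eta regs s with r |-> v] (memory s))
| ExecStore a b s i v :
    eval W s a = Some i -> eval W s b = Some v ->
    exec W (Store a b) s (cost a + cost b).+1
      (State (regs s) [eta memory s with i |-> v])
| ExecSeq p q s t1 s1 t2 s2 :
    exec W p s t1 s1 -> exec W q s1 t2 s2 ->
    exec W (Seq p q) s (t1 + t2) s2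
| ExecIf a p q s v t s' :
    eval W s a = Some v -> exec W (if v != 0 then p else q) s t s' ->
    exec W (If a p q) s (cost a + t).+1 s'
| ExecWhileStop a p s :
    eval W s a = Some 0 ->
    exec W (While a p) s (cost a).+1 s
| ExecWhileStep a p s v t1 s1 t2 s2 :
    eval W s a = Some v -> v != 0 ->
    exec W p s t1 s1 -> exec W (While a p) s1 t2 s2 ->
    exec W (While a p) s (cost a + t1 + t2).+1 s2.

(** * Input and output conventions *)

Definition initial_state (input : seq nat) : state :=
  State (fun _ => 0) (nth 0 input).

(* n, then the adjacency lists of the vertices 0, ..., n - 1 in this order,
   each preceded by its length. *)
Definition encode_graph (n : nat) (adj : 'I_n -> seq 'I_n) : seq nat :=
  n :: flatten
    [seq size (adj x) :: [seq val y | y <- adj x] | x <- enum 'I_n].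

(* A partition (V_1, ..., V_k) of the vertices 0, ..., n - 1 is returned as k
   in cell 0 and, for each vertex v, the index of its part in cell v + 1. *)
Definition output_partition (n : nat) (s : state) : seq {set 'I_n} :=
  [seq [set v : 'I_n | memory s v.+1 == i] | i <- iota 1 (memory s 0)].

(* For every fixed [c], values below this bound are words of O(log N) bits. *)
Definition word_bound (c N : nat) : nat := N.+1 ^ c.

(* Main.v *)
Require Import Defs.
From mathcomp Require Import all_boot.
From mathcomp Require Import zify.
Import Defs.

(** A vertex [v] can be put into part [k] iff distinct neighbours of degree at
    least [deg v] can be put into the parts [1 .. k - 1], none of them relying
    on [v]. In a tree this recursion runs over directed edges: let the message
    from [v] to its neighbour [q] be the largest [k] attainable by [v] without
    using [q]. It is obtained from the messages to [v] by greedy matching, and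
    deleting one incoming message lowers the result by at most one, by exactly
    one iff the message exceeds a threshold read off the matching. Hence one
    upward and one downward sweep of the rooted tree compute all the messages in
    linear time. Rerooting at a vertex of maximum rank and sweeping upward once
    more, the greedy slots of the children form an optimal partition. Optimality
    does not need the tree: whenever [f] numbers the parts of a partition and
    [f u <= f q], the message from [u] to [q] is at least [f u], since the
    dominators of [u] have smaller part numbers and so differ from [q]. *)

(** Linear time rests on truncating levels at the degree: a vertex sorts its neighbours by counting
    in [(deg e v).+1] buckets, and the threshold [slack] then answers each neighbour in constant
    time, so processing costs a constant times [(deg e v).+1]. Rerooting is forced by the output: an
    unrestricted rank [M v v] may count the parent, whereas parts are handed from parent to child
    and a child may rely only on its own children, hence on [M v (par v)]. Only at the root do the
    two values agree automatically, so the root must be where the rank is maximal. Surplus children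
    go to part 1, which requires no dominator. Messages are specified as some fixpoint of a monotone
    operator instead of by recursion over subtrees; the sweeps and the upper bound then speak of the
    same function [M]. Excluding the parent is realised by a message 0 from it, so that a single
    routine [process] serves all three sweeps. *)

Set Implicit Arguments.
Unset Strict Implicit.
Unset Printing Implicit Defensive.

(** * Ranks and messages *)

(* One plus the number of slots filled greedily, in a multiset with [c i]
   elements of value [i], when slot [i] wants an element of value at least
   [i]. *)
Fixpoint grank (c : nat -> nat) (d : nat) : nat :=
  if d is d'.+1 then minn d.+1 (grank c d' + c d) else 1.

(* The last value some elements of which remain unused. *)
Fixpoint slack (c : nat -> nat) (d : nat) : nat :=
  if d is d'.+1 then if d.+1 < grank c d' + c d then d else slack c d'
  else 0.

Lemma eq_grank c1 c2 d :
  (forall i, 0 < i -> c1 i = c2 i) -> grank c1 d = grank c2 d.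
Proof. by move=> eqc; elim: d => //= d ->; rewrite eqc. Qed.

Lemma grank_gt0 c d : 0 < grank c d.
Proof. by elim: d => //= d IHd; lia. Qed.

Lemma grank_le c d : grank c d <= d.+1.
Proof. by case: d => //= d; lia. Qed.

Lemma slack_le c d : slack c d <= d.
Proof. by elim: d => //= d IHd; case: ifP => _; lia. Qed.

(** Unrolling the minima gives a Hall-type formula: the rank is the least [t.+1] plus the number of
    elements of value above [t]. In this form monotonicity and lower bounds can be checked threshold
    by threshold. *)
Lemma leq_grankP c d x :
  x <= grank c d <->
  (forall t, t <= d -> x <= t.+1 + \sum_(t.+1 <= i < d.+1) c i).
Proof.
elim: d x => [|d IHd] x /=.
  split=> [x1 t|/(_ 0 isT)]; last by rewrite big_geq.
  by rewrite leqn0 => /eqP->; rewrite big_geq // addn0.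
rewrite leq_min; split=> [/andP[xd xr] t td|H].
  have [td' | td'] := leqP t d; last by rewrite big_geq //; lia.
  rewrite big_nat_recr //=.
  have := (IHd (x - c d.+1)).1 _ t td'; lia.
apply/andP; split; first by have := H d.+1 (leqnn _); rewrite big_geq //; lia.
have := (IHd (x - c d.+1)).2.
suff h t : t <= d -> x - c d.+1 <= t.+1 + \sum_(t.+1 <= i < d.+1) c i.
  by move/(_ h); lia.
by move=> td; have := H t (leqW td); rewrite big_nat_recr //=; lia.
Qed.

(** Below [a] nothing changes; at [a] one element is missing, and the loss persists until a
    truncation by [minn], at [a] or later, discards a surplus. [slack] is the last place where a
    surplus is discarded. *)
Lemma grank_excl c c' a d : 0 < a <= d ->
  (forall i, 0 < i -> c i = c' i + (i == a)) ->
  grank c' d = grank c d - (slack c d < a).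
Proof.
move=> ad eqc; elim: d ad => [|d IHd] /= ad; first lia.
rewrite (eqc d.+1) //.
have := slack_le c d; have := grank_gt0 c d; have := grank_le c d.
have [ead|nad] := eqVneq d.+1 a.
  have -> : grank c' d = grank c d.
    rewrite -{}ead {IHd ad} in eqc; have: d < d.+1 by [].
    elim: {1 3 4}d => //= i IHi id.
    by rewrite IHi ?(eqc i.+1) ?[_ == d.+1]ltn_eqF ?addn0 //; lia.
  by case: ifP => /=; lia.
rewrite IHd; last lia.
by have := grank_gt0 c' d; rewrite IHd; [case: ifP => /=; lia|lia].
Qed.

Lemma eq_slack c1 c2 d : (forall i, c1 i = c2 i) -> slack c1 d = slack c2 d.
Proof. by move=> eqc; elim: d => //= d ->; rewrite (@eq_grank c1 c2) ?eqc. Qed.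

(** * Fixpoints of bounded monotone operators *)

Section MonotoneFixpoint.
Variables (X : finType) (F : (X -> nat) -> X -> nat) (B : nat).
Hypothesis F_mono : forall f g, (forall x, f x <= g x) -> forall x, F f x <= F g x.
Hypothesis F_le : forall f x, F f x <= B.

(** Iterating from 0 is pointwise increasing; each step that is not yet stable raises the sum of the
    values, which cannot exceed [#|X| * B]. *)
Lemma monotone_fixpoint : exists f, forall x, f x = F f x.
Proof.
pose it t := iter t F (fun=> 0).
have it_mono t x : it t x <= it t.+1 x.
  by elim: t x => //= t IHt; apply: F_mono.
have [/existsP[t /forallP fixt]|/existsPn nofix] :=
    boolP [exists t : 'I_(#|X| * B).+1, [forall x, it t x == it t.+1 x]].
  by exists (it t) => x; apply/eqP.
have grow t : t <= (#|X| * B).+1 -> t <= \sum_x it t x.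
  elim: t => // t IHt lt_t; apply: leq_ltn_trans (IHt (ltnW lt_t)) _.
  have /forallPn[x neqx] := nofix (Ordinal lt_t).
  rewrite (bigD1 x) // [X in _ < X](bigD1 x) //= -addSn leq_add //.
    by rewrite ltn_neqAle neqx it_mono.
  by apply: leq_sum => y _; apply: it_mono.
have := grow _ (leqnn _); rewrite ltnNge => /negP[].
rewrite -sum_nat_const; apply: leq_sum => x _; exact: F_le.
Qed.

End MonotoneFixpoint.

Section Ranks.
Variables (V : finType) (e : rel V).
Implicit Types (u v w q : V) (f g : V -> nat).

Definition nbr_count v (P : pred V) : nat := #|[set w | e v w & P w]|.

Definition rank v g : nat := grank (fun i => nbr_count v (fun w => g w == i)) (deg e v).

Lemma nbr_count_le v P : nbr_count v P <= deg e v.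
Proof. by apply: subset_leq_card; apply/subsetP=> w; rewrite !inE => /andP[]. Qed.

Lemma eq_nbr_count v (P1 P2 : pred V) : (forall w, e v w -> P1 w = P2 w) ->
  nbr_count v P1 = nbr_count v P2.
Proof.
by move=> eqP; apply: eq_card => w; rewrite !inE; case vw: (e v w) => //=; apply: eqP.
Qed.

Lemma eq_rank v g1 g2 : (forall w, e v w -> g1 w = g2 w) -> rank v g1 = rank v g2.
Proof. by move=> eqg; apply: eq_grank => i _; apply: eq_nbr_count => w /eqg->. Qed.

(** By [g_le], each neighbour with [t < g w] is counted in exactly one summand of [leq_grankP]. *)
Lemma leq_rankP v g x : (forall w, e v w -> g w <= deg e v) ->
  x <= rank v g <->
  (forall t, t <= deg e v -> x <= t.+1 + nbr_count v (fun w => t < g w)).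
Proof.
move=> g_le; rewrite leq_grankP.
suff eq_count t : nbr_count v (fun w => t < g w) =
    \sum_(t.+1 <= i < (deg e v).+1) nbr_count v (fun w => g w == i).
  by split=> H t td; have := H t td; rewrite eq_count.
transitivity (\sum_(w | e v w && (t < g w)) \sum_(t.+1 <= i < (deg e v).+1) (g w == i)).
  rewrite /nbr_count cardsE -sum1_card; apply: eq_bigr => w; rewrite unfold_in => /andP[vw tw].
  rewrite (bigD1_seq (g w)) ?iota_uniq //=; last first.
    by rewrite mem_index_iota tw ltnS g_le.
  by rewrite eqxx big1 // => i /negbTE; rewrite eq_sym => ->.
rewrite exchange_big /=; apply: eq_big_nat => i /andP[ti _].
rewrite /nbr_count cardsE -sum1_card big_mkcond [RHS]big_mkcond /=.
apply: eq_bigr => w _; rewrite unfold_in.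
case: (e v w) => //=; case: eqP => [->|_] /=; first by rewrite ti.
by case: ifP.
Qed.

(** Level 0 means useless to [v], since [grank] never reads [c 0]. The truncation loses nothing,
    because [deg e v] neighbours cannot fill a slot beyond [deg e v], and it makes bucket counting
    affordable. *)
Definition level (m : V -> V -> nat) v q w : nat :=
  if (w != q) && (deg e v <= deg e w) then minn (m w v) (deg e v) else 0.

Lemma level_le m v q w : level m v q w <= deg e v.
Proof. by rewrite /level; case: ifP => // _; lia. Qed.

(* [m v q] is the best rank of [v] without the help of [q]; as [v] is not its
   own neighbour, [m v v] is the unrestricted rank. *)
Definition messages (m : V -> V -> nat) : Prop :=
  forall v q, m v q = rank v (level m v q).

(** A message depends on other messages, possibly in a circle; [leq_rankP] shows the operator on
    pairs to be monotone, so a fixpoint exists in any graph. *)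
Lemma messages_exist : exists m, messages m.
Proof.
pose F (f : V * V -> nat) x := rank x.1 (level (fun v q => f (v, q)) x.1 x.2).
have [f g fg x|f x|f fixf] := @monotone_fixpoint _ F #|V|.+1.
- have := leqnn (F f x); rewrite [X in _ <= X -> _]/F.
  move/leq_rankP => H; apply/leq_rankP => [w _|t td]; first exact: level_le.
  apply: leq_trans (H _ t td) _ => [w _|]; first exact: level_le.
  rewrite leq_add2l; apply: subset_leq_card; apply/subsetP => w; rewrite !inE.
  case/andP=> -> /=; rewrite /level; case: ifP => // _.
  by have := fg (w, x.1); lia.
- by apply: leq_trans (grank_le _ _) _; rewrite ltnS max_card.
- by exists (fun v q => f (v, q)) => v q; rewrite fixf.
Qed.

Lemma rank_excl v g g' u : e v u -> 0 < g u -> g' u = 0 ->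
  (forall w, e v w -> w != u -> g' w = g w) ->
  (forall w, e v w -> g w <= deg e v) ->
  rank v g' =
  rank v g - (slack (fun i => nbr_count v (fun w => g w == i)) (deg e v) < g u).
Proof.
move=> vu gu0 g'u g'E g_le; apply: grank_excl => [|i i_gt0].
  by rewrite gu0 g_le.
rewrite /nbr_count (cardsD1 u) addnC inE vu /= eq_sym; congr (_ + _).
apply: eq_card => w; rewrite !inE; case: eqVneq => [->|nwu] /=.
  by rewrite g'u; case: (i) i_gt0 => // j; rewrite andbF.
by case vw: (e v w) => //=; rewrite g'E.
Qed.

(** Excluding [v] excludes no neighbour, as [e] is irreflexive; excluding [u] instead changes only
    the level of [u], to 0. Thus the rank and slack computed once at [v] determine the messages to
    all its neighbours. *)
Lemma message_excl m v u g : irreflexive e -> messages m -> e v u ->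
  (forall w, e v w -> g w = level m v v w) ->
  m v u = rank v g -
    (slack (fun x => nbr_count v (fun w => g w == x)) (deg e v) < g u).
Proof.
move=> e_irr mE vu gE; rewrite mE (eq_rank gE) gE //.
rewrite (@eq_slack _ (fun x => nbr_count v (fun w => level m v v w == x))); last first.
  by move=> x; apply: eq_nbr_count => w /gE->.
have levelE w : e v w -> w != u -> level m v u w = level m v v w.
  by rewrite /level => vw ->; case: eqVneq vw => // ->; rewrite e_irr.
have level_u : level m v u u = 0 by rewrite /level eqxx.
have [gu0|gu_gt0] := posnP (level m v v u).
  rewrite gu0 ltn0 subn0; apply: eq_rank => w vw.
  by have [->|/(levelE w vw)] := eqVneq w u; rewrite ?gu0.
by apply: rank_excl => // w _; apply: level_le.
Qed.

(** * Rankings, their upper bound, and their correspondence with partitions *)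

Definition ranking f : Prop :=
  forall v i, 0 < i < f v -> exists w, [/\ e v w, deg e v <= deg e w & f w = i].

(* The strong dominators required by [u] have ranks below [f u <= f q], so none
   of them is [q]. *)
Lemma ranking_le_message m f : messages m -> ranking f ->
  forall u q, f u <= f q -> f u <= m u q.
Proof.
move=> mE rk u q; move: {2}(f u) (leqnn (f u)) => N.
elim: N u q => [|N IHN] u q fuN fuq; first lia.
(* The dominators of [u] take every value strictly between [t] and [f u]; distinct values belong to
   distinct neighbours, so [f u - t.+1] of them satisfy [P]. *)
have many t (P : pred V) : (forall w, deg e u <= deg e w -> t < f w < f u -> e u w -> P w) ->
    f u <= t.+1 + nbr_count u P.
  move=> HP; rewrite -leq_subLR.
  suff: size (iota t.+1 (f u - t.+1)) <= size [seq f w | w in [set w | e u w & P w]].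
    by rewrite size_iota size_image.
  apply: uniq_leq_size (iota_uniq _ _) _ => i; rewrite mem_iota => /andP[ti iu].
  have [|w [uw dw fw]] := rk u i; first lia.
  apply/imageP; exists w => //; rewrite inE uw HP // fw; lia.
rewrite mE; apply/leq_rankP => [w _|t td]; first exact: level_le.
(* No level exceeds [deg e u], so at [t = deg e u] the claim is just [f u <= (deg e u).+1], which
   follows by counting all neighbours. *)
move: td; rewrite leq_eqVlt => /orP[/eqP tE|td].
  apply: leq_trans (many 0 xpredT _) _ => //.
  by have := nbr_count_le u xpredT; lia.
apply: many => w dw /andP[tw wu] uw; rewrite /level dw andbT.
have -> : w != q by apply: contraTneq wu => ->; rewrite -leqNgt.
by have := IHN w u; lia.
Qed.

Hypothesis e_sym : symmetric e.

(** No part is empty: [r] lies in part [k] and has a dominator in every lower part. *)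
Lemma ranking_strong_transitive f k r :
  (forall v, 0 < f v <= k) -> f r = k -> ranking f ->
  strong_transitive_partition e [seq [set v | f v == i] | i <- iota 1 k].
Proof.
move=> f_le frk rk; set P := [seq _ | i <- _].
have fV i : 0 < i <= k -> exists v, f v = i.
  move=> ik; have [ltik|geik] := ltnP i k; last by exists r; lia.
  by have [|w [_ _ <-]] := rk r i; [lia|exists w].
have uP : uniq P.
  rewrite map_inj_in_uniq ?iota_uniq // => i j.
  rewrite !mem_iota => ik _ /setP eqij; have [|v fv] := fV i; first lia.
  by have := eqij v; rewrite !inE fv eqxx => /esym/eqP.
apply/and3P; split=> //.
  apply/and3P; split.
  - apply/eqP/setP => v; rewrite inE; apply/bigcupP.
    exists [set w | f w == f v]; last by rewrite inE.
    by rewrite inE map_f // mem_iota; have := f_le v; lia.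
  - apply/trivIsetP => A B; rewrite !inE => /mapP[i _ ->] /mapP[j _ ->] neqij.
    rewrite -setI_eq0; apply/eqP/setP => v; rewrite !inE.
    by apply: contraNF neqij => /andP[/eqP<- /eqP<-].
  - rewrite inE; apply/mapP => -[i]; rewrite mem_iota => ik /setP i0.
    have [|v fv] := fV i; first lia.
    by have := i0 v; rewrite !inE fv eqxx.
rewrite pairwise_map.
have : pairwise ltn (iota 1 k).
  by rewrite -sorted_pairwise ?iota_ltn_sorted //; exact: ltn_trans.
apply: sub_in_pairwise (allss _) => i j; rewrite !mem_iota => ik jk ij.
apply/forall_inP => v; rewrite inE => /eqP fv.
have [|w [vw dvw fw]] := rk v i; first lia.
by apply/exists_inP; exists w; rewrite ?inE ?fw // e_sym vw.
Qed.

Lemma strong_transitive_ranking P : strong_transitive_partition e P ->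
  exists f, ranking f /\ forall k, k <= size P -> 0 < k -> exists v, f v = k.
Proof.
case/and3P=> uP pP /(pairwiseP set0) dP; have /and3P[/eqP cP tP nP] := pP.
have memP i : i < size P -> nth set0 P i \in [set:: P] by rewrite inE; exact: mem_nth.
pose f v := (index (pblock [set:: P] v) P).+1.
have fE v i : i < size P -> v \in nth set0 P i -> f v = i.+1.
  by move=> iP vi; rewrite /f (def_pblock tP (memP _ iP) vi) index_uniq.
have fP v : f v <= size P.
  have : v \in cover [set:: P] by rewrite cP inE.
  by move/pblock_mem; rewrite inE -index_mem.
have vf v : v \in nth set0 P (f v).-1.
  by rewrite /= nth_index ?mem_pblock ?cP ?inE // -index_mem; exact: fP.
exists f; split=> [v i /andP[i0 iv]|k kP k0].
  have fvP := fP v.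
  have /forall_inP/(_ v (vf v))/exists_inP[] : strongly_dominates e
      (nth set0 P i.-1) (nth set0 P (f v).-1).
    by apply: dP; [change (i.-1 < size P)|change ((f v).-1 < size P)|]; lia.
  move=> w wi /andP[wv dvw]; exists w; split; rewrite 1?e_sym //.
  by rewrite (fE _ i.-1) //; lia.
have kP' : k.-1 < size P by lia.
have /set0Pn[v vk] : nth set0 P k.-1 != set0.
  by apply: contraNneq nP => <-; apply: memP.
by exists v; rewrite (fE _ _ kP' vk) prednK.
Qed.

End Ranks.

(** * Rooted trees *)

Section Rooted.
Variables (V : finType) (e : rel V).
Hypotheses (e_simple : simple_graph e) (e_tree : tree e).

(** A path avoiding the edge shortens to a duplicate-free one, which the edge closes to a [ucycle].
    Its size is at least 3, since a single step from [v] to [w] would be the removed edge. *)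
Lemma tree_bridge (v w : V) : e v w ->
  ~~ connect [rel x y | e x y && ([set x; y] != [set v; w])] v w.
Proof.
have [e_sym e_irr] := e_simple; have [_ _ acyclic] := e_tree.
move=> vw; apply/negP => /connectP[p0 /shortenP[p path_p uniq_p _] w_def].
have /acyclic : ucycle e (v :: p).
  apply/andP; split=> //=; rewrite rcons_path -w_def e_sym vw andbT.
  by apply: sub_path path_p => x y /andP[].
case: p path_p uniq_p w_def => [|x [|y p]] //= path_p _ w_def.
  by rewrite w_def e_irr in vw.
by rewrite w_def eqxx andbF in path_p.
Qed.

(** [o] may be incomplete, so that it also describes the queue of an unfinished search. With
    [par r = r], the parent of the root is never one of its neighbours, and the test against the
    parent needs no special case. *)
Definition rooted (r : V) (o : seq V) (par : V -> V) : Prop :=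
  [/\ uniq o, r \in o, par r = r
    & forall u, u \in o -> u != r ->
        [/\ par u \in o, index (par u) o < index u o & e (par u) u]].

(** Otherwise [v] and [w] would both reach [r] along parent links other than the edge between them,
    against [tree_bridge]. *)
Lemma rooted_adj r o par v w : rooted r o par -> v \in o -> w \in o -> e v w ->
  (w == par v) || (v == par w).
Proof.
have [e_sym e_irr] := e_simple.
case=> _ _ _ parP vo wo vw; apply/norP => -[wv vw'].
pose e' := [rel x y | e x y && ([set x; y] != [set v; w])].
have e'_sym : symmetric e' by move=> x y; rewrite /= e_sym setUC.
have to_root u : u \in o -> connect e' r u.
  have [m] := ubnP (index u o); elim: m u => // m IHm u um uo.
  have [->|ur] := eqVneq u r; first exact: connect0.
  have [po pu pe] := parP u uo ur.
  apply: connect_trans (IHm _ _ po) _; first by lia.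
  apply: connect1; rewrite /= pe /=; apply: contraNneq wv => /setP eqs.
  have := eqs (par u); have := eqs u; rewrite !inE !eqxx orbT /=.
  case/esym/orP=> /eqP eu; case/esym/orP=> /eqP epu //; subst u.
  - by move: pe; rewrite epu e_irr.
  - by rewrite epu.
  - by rewrite -epu eqxx in vw'.
  - by move: pe; rewrite epu e_irr.
have /negP[] := tree_bridge vw.
apply: connect_trans (to_root w wo); by rewrite sym_connect_sym // to_root.
Qed.

(* State of a breadth-first search with queue [o], where [seen x y] means that
   the neighbour [y] of [x] has been examined. *)
Definition scan_inv (r : V) (seen : rel V) (o : seq V) (par : V -> V) : Prop :=
  [/\ rooted r o par, forall x y, seen x y -> (x \in o) && (y \in o)
    & forall u, u \in o -> u != r -> seen (par u) u].

Lemma eq_scan_inv r seen seen' o par : seen =2 seen' ->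
  scan_inv r seen o par -> scan_inv r seen' o par.
Proof.
move=> eq_seen [rt closed par_seen]; split=> // [x y|u uo ur].
  by rewrite -eq_seen => /closed.
by rewrite -eq_seen par_seen.
Qed.

Lemma scan_inv_start r : scan_inv r (fun _ _ => false) [:: r] (fun=> r).
Proof.
split=> // [|u]; last by rewrite inE => ->.
by split=> // [|u]; rewrite inE // => ->.
Qed.

Lemma scan_inv_skip r seen o par v : scan_inv r seen o par -> v \in o ->
  scan_inv r (fun x y => seen x y || (x == v) && (y == par v)) o par.
Proof.
case=> [[uo ro parr parP] closed par_seen] vo; split=> // [x y|u uo' ur].
  case/orP=> [/closed//|/andP[/eqP-> /eqP->]]; rewrite vo.
  by have [->|/(parP v vo)[]//] := eqVneq v r; rewrite parr.
by rewrite par_seen.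
Qed.

(** If [u] were already queued, [rooted_adj] would give [v = par u], and the link from a parent to a
    queued child has been examined, against [~~ seen v u]. *)
Lemma scan_inv_add r seen o par v u : scan_inv r seen o par -> v \in o ->
  e v u -> u != par v -> ~~ seen v u ->
  u \notin o /\
  scan_inv r (fun x y => seen x y || (x == v) && (y == u)) (rcons o u)
    [eta par with u |-> v].
Proof.
case=> rt closed par_seen vo vu neq_u nseen; have [uo ro parr parP] := rt.
have nuo : u \notin o.
  apply: contra nseen => uo'; have := rooted_adj rt vo uo' vu.
  rewrite (negbTE neq_u) /= => /eqP vE; rewrite vE in neq_u *.
  apply: par_seen => //; apply: contraNneq neq_u => ur.
  by rewrite ur !parr.
have neq x : x \in o -> (x == u) = false.
  by move=> xo; apply: contraNF nuo => /eqP<-.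
have idx x : x \in o -> index x (rcons o u) = index x o.
  by move=> xo; rewrite -cats1 index_cat xo.
split=> //; split.
- split=> /=.
  + by rewrite rcons_uniq nuo.
  + by rewrite mem_rcons inE ro orbT.
  + by rewrite neq.
  + move=> x; rewrite mem_rcons inE; case: eqVneq => [->|neq_xu] /= xo xr.
      rewrite mem_rcons inE vo orbT idx // -cats1 index_cat (negbTE nuo) /= eqxx.
      by rewrite addn0 index_mem.
    have [po pi pe] := parP x xo xr.
    by rewrite mem_rcons inE po orbT !idx.
- move=> x y; rewrite !mem_rcons !inE.
  case/orP=> [/closed/andP[-> ->]|/andP[/eqP-> ->]]; by rewrite ?vo !orbT.
- move=> x; rewrite mem_rcons inE /=; case: eqVneq => [->|neq_xu] /= xo xr.
    by rewrite !eqxx orbT.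
  by rewrite par_seen.
Qed.

Lemma scan_inv_all r seen o par : scan_inv r seen o par ->
  (forall x y, x \in o -> e x y -> seen x y) -> forall x, x \in o.
Proof.
have [_ conn _] := e_tree; case=> [[_ ro _ _] seen_in _] all_seen x.
have cl : closed e (mem o).
  apply: intro_closed; first by apply: sym_connect_sym; case: e_simple.
  by move=> y z yz yo; have /andP[] := seen_in _ _ (all_seen y z yo yz).
by rewrite -(closed_connect cl (conn r x)).
Qed.

Lemma child r o par v w : rooted r o par -> (forall u, u \in o) -> e v w ->
  w != par v -> [/\ par w = v, w != r & index v o < index w o].
Proof.
move=> rt all_o vw neq_w; have [_ _ parr parP] := rt.
have := rooted_adj rt (all_o v) (all_o w) vw; rewrite (negbTE neq_w) /= => /eqP vE.
have [_ e_irr] := e_simple.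
have wr : w != r by apply: contraTneq vw => wr; rewrite vE wr parr e_irr.
by have [_] := parP w (all_o w) wr; rewrite -vE.
Qed.

Lemma parent r o par v : rooted r o par -> v \in o -> e v (par v) ->
  v != r /\ index (par v) o < index v o.
Proof.
case=> _ _ parr parP vo vp; have [_ e_irr] := e_simple.
have vr : v != r by apply: contraTneq vp => ->; rewrite parr e_irr.
by have [] := parP v vo vr.
Qed.

(** The degrees count ordered adjacent pairs, of which at most two have the same underlying edge. *)
Lemma sum_deg_le : \sum_v deg e v <= 2 * #|edges e|.
Proof.
pose A : {set V * V} := [set u | e u.1 u.2].
pose h (u : V * V) : {set V} := [set u.1; u.2].
have -> : \sum_v deg e v = \sum_(u in A) 1.
  under eq_bigr => v _ do rewrite /deg -sum1_card big_mkcond.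
  rewrite pair_big /= [RHS]big_mkcond; apply: eq_bigr => -[x y] _.
  by rewrite !inE.
rewrite (partition_big_imset h) /= mulnC.
have -> : h @: A = edges e.
  by apply/setP => E; apply/imsetP/imsetP => -[u]; rewrite inE => eu ->; exists u; rewrite ?inE.
rewrite -sum_nat_const; apply: leq_sum => E /imsetP[[x y] _ ->].
rewrite sum1_card; apply: leq_trans (_ : #|[set (x, y); (y, x)]| <= 2); last first.
  by rewrite cards2; case: eqP.
apply: subset_leq_card; apply/subsetP => -[a b]; rewrite !inE /= => /andP[_ /eqP/setP eqs].
have := eqs x; have := eqs y; have := eqs a; have := eqs b.
rewrite !inE !eqxx ?orbT /= !xpair_eqE.
by case/esym/orP=> /eqP->; case/esym/orP=> /eqP->;
  rewrite ?eqxx ?orbT ?andbT //= !orbb 1?eq_sym // => ->.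
Qed.

End Rooted.

(** * Program logic *)

Definition setr (s : state) (r v : nat) : state :=
  State [eta regs s with r |-> v] (memory s).

(* Memory is used as a table whose rows have [K] cells, [K] being kept in
   register 1: cell [x] of row [j] has address [j * K + x], and row 0 is the
   input. *)
Definition cell_addr (j : nat) (a : expr) : expr :=
  Plus (iter j (Plus (Reg 1)) (Lit 0)) a.

Definition get (j : nat) (a : expr) : expr := Mem (cell_addr j a).

Definition put (j : nat) (a b : expr) : cmd := Store (cell_addr j a) b.

Definition tab (K : nat) (m : nat -> nat) (j x : nat) : nat := m (j * K + x).

Definition set_tab (K : nat) (m : nat -> nat) (j x v : nat) : nat -> nat :=
  [eta m with j * K + x |-> v].

Definition for_loop (i b : nat) (p : cmd) : cmd :=
  Seq (Assign i (Lit 0))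
    (While (Minus (Reg b) (Reg i)) (Seq p (Assign i (Plus (Reg i) (Lit 1))))).

(** Division by [K] recovers the row from an address, so distinct cells do not collide. *)
Lemma tab_set K m j x v i y : x < K -> y < K ->
  tab K (set_tab K m j x v) i y = if (i == j) && (y == x) then v else tab K m i y.
Proof.
rewrite /tab /set_tab /= => xK yK; have [->|nij] /= := eqVneq i j; first by rewrite eqn_add2l.
rewrite ifN //; apply: contra nij => /eqP eqa; apply/eqP.
have K_gt0 : 0 < K by lia.
have := congr1 (divn^~ K) eqa.
by rewrite !divnMDl // !divn_small // !addn0.
Qed.

Fixpoint value (s : state) (a : expr) : nat :=
  match a with
  | Lit v => v
  | Reg r => regs s r
  | Mem a1 => memory s (value s a1)
  | Plus a1 a2 => value s a1 + value s a2
  | Minus a1 a2 => value s a1 - value s a2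
  end.

Fixpoint writes (p : cmd) (r : nat) : bool :=
  match p with
  | Assign i _ => r == i
  | Seq p q | If _ p q => writes p r || writes q r
  | While _ p => writes p r
  | _ => false
  end.

Lemma value_addr s j a : value s (cell_addr j a) = j * regs s 1 + value s a.
Proof. by rewrite /=; congr (_ + _); elim: j => //= j ->; rewrite mulSn. Qed.

Lemma value_get K s j a : regs s 1 = K ->
  value s (get j a) = tab K (memory s) j (value s a).
Proof. by rewrite /tab => <-; rewrite -value_addr. Qed.

(** The machine cannot multiply, so a row offset is [j] additions of register 1; as [j] is fixed by
    the program text, each access takes constant time. *)
Lemma cost_addr j a : cost (cell_addr j a) = 2 * j + 2 + cost a.
Proof. by rewrite /=; elim: j => /= [|j IHj]; lia. Qed.

Lemma cost_get j a : cost (get j a) = 2 * j + 3 + cost a.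
Proof.
by rewrite /get -addn1 -[2 * j + 3]/(2 * j + (2 + 1)) addnA addnAC -cost_addr addn1.
Qed.

Section Execution.
Variable W : nat.

(** [eval] is stuck on overflow; [fits] collects the bounds under which it agrees with the total
    function [value]. *)
Fixpoint fits (s : state) (a : expr) : bool :=
  match a with
  | Lit v => v < W
  | Reg _ => true
  | Mem a1 => fits s a1
  | Plus a1 a2 => [&& fits s a1, fits s a2 & value s a1 + value s a2 < W]
  | Minus a1 a2 => fits s a1 && fits s a2
  end.

Lemma eval_value s a : fits s a -> eval W s a = Some (value s a).
Proof.
elim: a => //= [v vW|a IHa /IHa -> //|a IHa b IHb|a IHa b IHb].
- by rewrite /word vW.
- by case/and3P=> /IHa -> /IHb -> lW; rewrite /word lW.
- by case/andP=> /IHa -> /IHb ->.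
Qed.

Lemma fits_addr s j a :
  fits s (cell_addr j a) = fits s a && (j * regs s 1 + value s a < W).
Proof.
rewrite -value_addr /=; case: (fits s a); rewrite ?andbF //=.
set b := iter _ _ _; apply/andP/idP => [[]//|lW]; split=> //.
have {lW}: value s b < W by lia.
by rewrite {}/b; elim: j => //= j IHj lW; rewrite lW IHj //; lia.
Qed.

Lemma fits_get s j a :
  fits s (get j a) = fits s a && (j * regs s 1 + value s a < W).
Proof. exact: fits_addr. Qed.

Definition wp (p : cmd) (s : state) (Q : nat -> state -> Prop) : Prop :=
  exists t s', exec W p s t s' /\ Q t s'.

Lemma exec_regs p s t s' r :
  exec W p s t s' -> ~~ writes p r -> regs s' r = regs s r.
Proof.
elim=> {p s t s'} //=.
- by move=> s i a v _ /negbTE->.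
- by move=> p q s t1 s1 t2 s2 _ IH1 _ IH2 /norP[/IH1 <- /IH2].
- by move=> a p q s v t s' _ _ IH /norP[np nq]; apply: IH; case: ifP.
- by move=> a p s v t1 s1 t2 s2 _ _ _ IH1 _ IH2 np; rewrite IH2 // IH1.
Qed.

Lemma wp_regs p s Q :
  wp p s (fun t s' => (forall r, ~~ writes p r -> regs s' r = regs s r) -> Q t s') ->
  wp p s Q.
Proof.
case=> t [s' [ex_p Qs']]; exists t, s'; split=> //.
by apply: Qs' => r; apply: exec_regs ex_p.
Qed.

Lemma wp_skip s (Q : nat -> state -> Prop) : Q 1 s -> wp Skip s Q.
Proof. by move=> Qs; exists 1, s; split=> //; constructor. Qed.

Lemma wp_assign r a s (Q : nat -> state -> Prop) :
  fits s a -> Q (cost a).+1 (setr s r (value s a)) -> wp (Assign r a) s Q.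
Proof.
move=> /eval_value ev_a Qs; exists (cost a).+1, (setr s r (value s a)).
by split=> //; constructor.
Qed.

Lemma wp_store a b s (Q : nat -> state -> Prop) : fits s a -> fits s b ->
  Q (cost a + cost b).+1 (State (regs s) [eta memory s with value s a |-> value s b]) ->
  wp (Store a b) s Q.
Proof.
move=> /eval_value ev_a /eval_value ev_b Qs.
exists (cost a + cost b).+1, (State (regs s) [eta memory s with value s a |-> value s b]).
by split=> //; constructor.
Qed.

Lemma wp_put K j a b s (Q : nat -> state -> Prop) : regs s 1 = K ->
  fits s a -> fits s b -> j * K + value s a < W ->
  Q (cost (cell_addr j a) + cost b).+1
    (State (regs s) (set_tab K (memory s) j (value s a) (value s b))) ->
  wp (put j a b) s Q.
Proof.
move=> sK fa fb lW Qs; apply: wp_store => //; first by rewrite fits_addr fa sK.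
by rewrite value_addr sK.
Qed.

Lemma wp_seq p q s (Q : nat -> state -> Prop) :
  wp p s (fun t1 s1 => wp q s1 (fun t2 s2 => Q (t1 + t2) s2)) -> wp (Seq p q) s Q.
Proof.
case=> t1 [s1 [ex_p [t2 [s2 [ex_q Qs2]]]]]; exists (t1 + t2), s2; split=> //.
exact: ExecSeq ex_p ex_q.
Qed.

Lemma wp_if a p q s (Q : nat -> state -> Prop) : fits s a ->
  (0 < value s a -> wp p s (fun t s' => Q (cost a + t).+1 s')) ->
  (value s a = 0 -> wp q s (fun t s' => Q (cost a + t).+1 s')) ->
  wp (If a p q) s Q.
Proof.
move=> /eval_value ev_a Hp Hq.
suff [t [s' [ex Qs']]] : wp (if value s a != 0 then p else q) s
    (fun t s' => Q (cost a + t).+1 s').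
  by exists (cost a + t).+1, s'; split=> //; apply: ExecIf ev_a ex.
by case: eqVneq => [/Hq//|]; rewrite -lt0n.
Qed.

(* [I k t s] is the invariant after [k] iterations and [t] time units; each
   iteration costs 8 units on top of its body. *)
Lemma wp_for i b p m (I : nat -> nat -> state -> Prop) s0 (Q : nat -> state -> Prop) :
  regs s0 b = m -> m < W -> 1 < W -> i != b -> ~~ writes p i -> ~~ writes p b ->
  (forall k t s v, I k t s -> I k t (setr s i v)) ->
  I 0 0 s0 ->
  (forall k t s, k < m -> regs s i = k ->
     (forall r, r != i -> ~~ writes p r -> regs s r = regs s0 r) ->
     I k t s -> wp p s (fun t' s' => I k.+1 (t + t' + 8) s')) ->
  (forall t s, (forall r, r != i -> ~~ writes p r -> regs s r = regs s0 r) ->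
     I m t s -> Q (t + 6) s) ->
  wp (for_loop i b p) s0 Q.
Proof.
move=> s0b mW W_gt1 nib npi npb I_setr I0 I_step I_end.
pose frame s := forall r, r != i -> ~~ writes p r -> regs s r = regs s0 r.
pose body := Seq p (Assign i (Plus (Reg i) (Lit 1))).
(* The 2 units pay for the initial assignment of the counter; the final failing test costs 4 more,
   whence the 6 in the postcondition. *)
suff loop d k t s : m - k = d -> k <= m -> regs s i = k -> frame s -> I k t s ->
    wp (While (Minus (Reg b) (Reg i)) body) s (fun t' s' => Q (t + t' + 2) s').
  apply/wp_seq/wp_assign => /=; first exact: ltnW.
  have := loop m 0 0 (setr s0 i 0); rewrite subn0; case=> //.
  - by rewrite /= eqxx.
  - by move=> r ri _ /=; rewrite (negbTE ri).
  - exact: I_setr.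
  by move=> t [s [ex Qs]]; exists t, s; split=> //; rewrite addnC.
elim: d k t s => [|d IHd] k t s mk km si fr Is.
  have ekm : k = m by lia.
  have sb : regs s b = m by rewrite fr // eq_sym.
  exists 4, s; split; first by constructor; rewrite /= sb si ekm subnn.
  by rewrite -addnA; apply: I_end => //; rewrite -ekm.
have sb : regs s b = m by rewrite fr // eq_sym.
have lt_km : k < m by lia.
have [t1 [s1 [ex1 I1]]] := I_step k t s lt_km si fr Is.
have s1i : regs s1 i = k by rewrite (exec_regs ex1).
have [|||||t2 [s2 [ex2 Qs2]]] := IHd k.+1 (t + t1 + 8) (setr s1 i k.+1).
- lia.
- by [].
- by rewrite /= eqxx.
- by move=> r ri np /=; rewrite (negbTE ri) (exec_regs ex1) // fr.
- exact: I_setr.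
exists (3 + (t1 + 4) + t2).+1, s2; split; last first.
  by rewrite (_ : t + _ + 2 = t + t1 + 8 + t2 + 2) //; lia.
apply: (@ExecWhileStep _ _ _ _ (m - k) (t1 + 4) (setr s1 i k.+1)) => //.
- by rewrite /= sb si.
- lia.
apply: ExecSeq ex1 _; apply: (@ExecAssign _ i (Plus (Reg i) (Lit 1)) s1 k.+1).
by rewrite /= /word W_gt1 s1i addn1 (leq_ltn_trans lt_km).
Qed.

End Execution.

Opaque cell_addr get tab set_tab.

(** * Local computation at a vertex *)

(* Registers: number of vertices, scan address, outer loop counter, root,
   maximum found, length of the queue, head of the queue; for the vertex being
   processed: its name, degree, adjacency address, parent, message from the
   parent, degree + 1, inner loop counter, rank, slack, slot, neighbour, level
   of the neighbour. Register 1 holds the row length of the memory table. *)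
Notation rN := 0 (only parsing).
Notation rA := 2 (only parsing).
Notation rI := 3 (only parsing).
Notation rR := 4 (only parsing).
Notation rB := 5 (only parsing).
Notation rT := 6 (only parsing).
Notation rH := 7 (only parsing).
Notation rV := 8 (only parsing).
Notation rD := 9 (only parsing).
Notation rO := 10 (only parsing).
Notation rP := 11 (only parsing).
Notation rU := 12 (only parsing).
Notation rE := 13 (only parsing).
Notation rJ := 14 (only parsing).
Notation rG := 15 (only parsing).
Notation rL := 16 (only parsing).
Notation rS := 17 (only parsing).
Notation rX := 18 (only parsing).
Notation rY := 19 (only parsing).

(* Rows of the memory table: 0 input and output, 1 degrees, 2 addresses of the
   adjacency lists, 3 parents, 4 vertices in breadth-first order, 5 messages
   from the parent, 6 messages to the parent (later, ranks), 7 assigned parts,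
   8 numbers of neighbours per level, 9 next free slot per level. *)

(** With truncated subtraction this is the absolute difference; it serves as the test for
    inequality. *)
Definition dist (a b : expr) : expr := Plus (Minus a b) (Minus b a).

Definition read_level : cmd :=
  Seq (Assign rX (Mem (Plus (Reg rO) (Reg rJ))))
  (Seq (If (Minus (Reg rD) (get 1 (Reg rX))) (Assign rY (Lit 0))
         (If (dist (Reg rX) (Reg rP)) (Assign rY (get 6 (Reg rX)))
            (Assign rY (Reg rU))))
    (Assign rY (Minus (Reg rY) (Minus (Reg rY) (Reg rD))))).

Definition clear_counts : cmd := for_loop rJ rE (put 8 (Reg rJ) (Lit 0)).

Definition count_levels : cmd :=
  for_loop rJ rD (Seq read_level
    (put 8 (Reg rY) (Plus (get 8 (Reg rY)) (Lit 1)))).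

Definition compute_rank : cmd :=
  for_loop rJ rD
    (Seq (put 9 (Plus (Reg rJ) (Lit 1)) (Reg rG))
    (Seq (Assign rG (Plus (Reg rG) (get 8 (Plus (Reg rJ) (Lit 1)))))
      (If (Minus (Reg rG) (Plus (Reg rJ) (Lit 2)))
        (Seq (Assign rL (Plus (Reg rJ) (Lit 1)))
          (Assign rG (Plus (Reg rJ) (Lit 2)))) Skip))).

Definition send_messages : cmd :=
  for_loop rJ rD (Seq read_level
    (If (dist (Reg rX) (Reg rP))
      (Seq (Assign rS (get 9 (Reg rY)))
      (Seq (If (Minus (Reg rY) (Reg rL)) (put 5 (Reg rX) (Minus (Reg rG) (Lit 1)))
             (put 5 (Reg rX) (Reg rG)))
        (If (Minus (Reg rS) (Reg rY)) (put 7 (Reg rX) (Lit 1))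
          (Seq (put 7 (Reg rX) (Reg rS))
            (put 9 (Reg rY) (Plus (Reg rS) (Lit 1)))))))
      Skip)).

(** The pointer 1 at level 0 already exceeds that level, so neighbours of level 0 are treated as
    surplus and receive part 1. *)
Definition process : cmd :=
  Seq (Assign rD (get 1 (Reg rV)))
  (Seq (Assign rO (get 2 (Reg rV)))
  (Seq (Assign rP (get 3 (Reg rV)))
  (Seq (Assign rU (get 5 (Reg rV)))
  (Seq (Assign rE (Plus (Reg rD) (Lit 1)))
  (Seq clear_counts
  (Seq (put 9 (Lit 0) (Lit 1))
  (Seq count_levels
  (Seq (Assign rG (Lit 1))
  (Seq (Assign rL (Lit 0))
  (Seq compute_rank
  (Seq send_messages
    (put 6 (Reg rV) (Reg rG))))))))))))).

(** * Layout of the encoded graph *)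

Section Input.
Variables (n : nat) (adj : 'I_n -> seq 'I_n).

Let blocks := [seq size (adj x) :: [seq val y | y <- adj x] | x <- enum 'I_n].

(** The successor skips cell 0, which holds [n]. The cell at this address is the length of the list;
    the neighbours start one cell later. *)
Definition block_addr (i : nat) : nat := (sumn (take i (shape blocks))).+1.

Let size_blocks : size (shape blocks) = n.
Proof. by rewrite 2!size_map size_enum_ord. Qed.

Let nth_blocks (v : 'I_n) :
  nth [::] blocks v = size (adj v) :: [seq val y | y <- adj v].
Proof. by rewrite (nth_map v) ?size_enum_ord // nth_ord_enum. Qed.

Let nth_shape (v : 'I_n) : nth 0 (shape blocks) v = (size (adj v)).+1.
Proof.
have lt_v : v < size blocks by rewrite -(size_map size) size_blocks.
by rewrite (nth_map [::]) // nth_blocks /= size_map.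
Qed.

Lemma block_addr_ord (v : 'I_n) :
  block_addr v.+1 = (block_addr v + size (adj v)).+1.
Proof.
rewrite /block_addr (take_nth 0) ?size_blocks // sumn_rcons nth_shape.
by rewrite addSn addnS.
Qed.

Lemma block_addr_end : block_addr n = size (encode_graph adj).
Proof.
by rewrite /block_addr -[X in take X]size_blocks take_size /= size_flatten.
Qed.

Lemma block_addr_mono i j : i <= j <= n -> block_addr i + (j - i) <= block_addr j.
Proof.
case/andP=> /subnK<-; elim: (j - i) => [|d IHd]; first by rewrite subnn addn0.
rewrite addSn => lt_n; have := block_addr_ord (Ordinal lt_n) => /= ->.
by have := IHd (ltnW lt_n); lia.
Qed.

Lemma nth_block (v : 'I_n) k : k <= size (adj v) ->
  nth 0 (encode_graph adj) (block_addr v + k) =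
  nth 0 (size (adj v) :: [seq val y | y <- adj v]) k.
Proof.
move=> kv; have lt_k : k < nth 0 (shape blocks) v by rewrite nth_shape.
rewrite /= nth_flatten -/blocks -/(flatten_index _ _ _) flatten_indexKl //.
by rewrite flatten_indexKr // nth_blocks.
Qed.

End Input.

Ltac fits_tac := rewrite /= ?fits_get ?fits_addr /=; lia.

Lemma dist_ord n (v w : 'I_n) : (0 < (v - w) + (w - v)) = (v != w).
Proof. by rewrite -(inj_eq val_inj) /=; lia. Qed.

Section Process.
Variables (n : nat) (e : rel 'I_n) (adj : 'I_n -> seq 'I_n).
Let K := size (encode_graph adj).
Hypothesis adjP : adjacency_lists e adj.

Implicit Types (m : nat -> nat) (s : state) (v w p : 'I_n).

Lemma mem_adj v w : (w \in adj v) = e v w.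
Proof. by have [_ ->] := adjP v. Qed.

Lemma count_adj v (P : pred 'I_n) : count P (adj v) = nbr_count e v P.
Proof.
have [uadj _] := adjP v; rewrite -size_filter /nbr_count cardsE.
rewrite -(card_uniqP (filter_uniq P uadj)); apply: eq_card => w.
by rewrite mem_filter unfold_in mem_adj andbC.
Qed.

Lemma size_adj v : size (adj v) = deg e v.
Proof.
rewrite -count_predT count_adj; apply: eq_card => w.
by rewrite !inE andbT.
Qed.

Lemma deg_le v : deg e v <= n.
Proof. by rewrite -[X in _ <= X]card_ord max_card. Qed.

Lemma K_gt : n < K.
Proof.
have := @block_addr_mono _ adj 0 n; rewrite /= leqnn => /(_ isT).
by rewrite block_addr_end -/K /block_addr take0 /=; lia.
Qed.

Lemma ord_lt v : v < K. Proof. exact: ltn_trans K_gt. Qed.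

Lemma block_lt v : block_addr adj v + deg e v < K.
Proof.
have := @block_addr_mono _ adj v.+1 n; rewrite ltn_ord leqnn => /(_ isT).
by rewrite block_addr_end -/K block_addr_ord size_adj; lia.
Qed.

Definition graph_tab m : Prop :=
  [/\ forall v, tab K m 1 v = deg e v, forall v, tab K m 2 v = (block_addr adj v).+1
    & forall x, x < K -> tab K m 0 x = nth 0 (encode_graph adj) x].

Definition agree (rows : seq nat) m m' : Prop :=
  forall j x, x < K -> j \notin rows -> tab K m' j x = tab K m j x.

Lemma agree_trans rows m1 m2 m3 :
  agree rows m1 m2 -> agree rows m2 m3 -> agree rows m1 m3.
Proof. by move=> a12 a23 j x xK jr; rewrite a23 // a12. Qed.

Lemma agree_sub rows rows' m m' : {subset rows <= rows'} ->
  agree rows m m' -> agree rows' m m'.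
Proof. by move=> sub a j x xK jr; apply: a => //; apply: contra (sub j) jr. Qed.

Lemma agree_set rows m m' j x z : x < K -> j \in rows ->
  agree rows m m' -> agree rows m (set_tab K m' j x z).
Proof.
move=> xK jr a i y yK ir; rewrite tab_set // a //.
by case: eqVneq ir => // ->; rewrite jr.
Qed.

Lemma agree_graph rows m m' : agree rows m m' ->
  ~~ has (mem rows) [:: 0; 1; 2] -> graph_tab m -> graph_tab m'.
Proof.
move=> a; rewrite /= !negb_or => /and4P[r0 r1 r2 _] [m1 m2 m0].
by split=> [v|v|x xK]; rewrite a ?ord_lt // ?m0.
Qed.

Lemma nth_adj m v j : graph_tab m -> j < deg e v ->
  m ((block_addr adj v).+1 + j) = nth v (adj v) j.
Proof.
case=> _ _ m0 jv; have lt_K : (block_addr adj v).+1 + j < K.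
  by have := block_lt v; lia.
have := m0 _ lt_K; rewrite -[tab _ _ _ _]/(m _) => ->.
by rewrite addSnnS nth_block ?size_adj //= (nth_map v) // size_adj.
Qed.

(** The level as the program sees it: [up] stands for the message from the parent [p], and [up = 0]
    has the effect of excluding [p]. *)
Definition cur_level m up v p w : nat :=
  if deg e v <= deg e w then minn (if w == p then up else tab K m 6 w) (deg e v)
  else 0.

Variable W : nat.
(** Ten rows of length [K] put every address below [10 * K]; the other factor 2 is room for sums. *)
Hypothesis W_large : 20 * K <= W.

Lemma wp_read_level s v p j (Q : nat -> state -> Prop) :
  regs s 1 = K -> graph_tab (memory s) -> regs s rO = (block_addr adj v).+1 ->
  regs s rJ = j -> j < deg e v -> regs s rD = deg e v -> regs s rP = p ->
  (forall t s', t <= 60 -> memory s' = memory s -> regs s' rX = nth v (adj v) j ->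
     regs s' rY = cur_level (memory s) (regs s rU) v p (nth v (adj v) j) ->
     (forall r, (r != rX) && (r != rY) -> regs s' r = regs s r) -> Q t s') ->
  wp W read_level s Q.
Proof.
move=> sK gs sO sJ jv sD sP HQ; set w := nth v (adj v) j.
have dv := deg_le v; have wK := ord_lt w; have Kn := K_gt.
have := block_lt v => bv; have [g1 _ _] := gs.
have {}HQ t s' : t <= 60 -> memory s' = memory s -> regs s' rX = w ->
     regs s' rY = cur_level (memory s) (regs s rU) v p w ->
     (forall r, ~~ writes read_level r -> regs s' r = regs s r) -> Q t s'.
  move=> le_t ms' s'X s'Y fr; apply: HQ => // r /andP[nX nY]; apply: fr.
  by rewrite /= !negb_or nX nY.
apply: wp_regs; apply/wp_seq/wp_assign; first by fits_tac.
have -> : value s (Mem (Plus (Reg rO) (Reg rJ))) = w.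
  by rewrite /= sO sJ nth_adj.
set s1 := setr s rX w.
have fits_row r j' : r < K -> j' < 10 -> forall s1 i, regs s1 1 = K ->
    regs s1 i = r -> fits W s1 (get j' (Reg i)).
  by move=> rK j10 s2 i s2K s2i; rewrite fits_get /= s2K s2i; nia.
apply/wp_seq; apply: wp_if.
- by rewrite /= (fits_row w).
- rewrite /= (@value_get K) //= g1 sD => lt_wv.
  apply: wp_assign; first by fits_tac.
  apply: wp_assign => //= fr; apply: HQ => //=.
  by rewrite /cur_level -/w leqNgt -subn_gt0 lt_wv.
rewrite /= (@value_get K) //= g1 sD => /eqP; rewrite subn_eq0 => le_vw.
apply: wp_if => [|/=|/=]; first by rewrite /= sP; have := ord_lt p; lia.
- rewrite sP dist_ord => neq_wp.
  apply: wp_assign; first by rewrite (fits_row w).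
  apply: wp_assign => //= fr; apply: HQ => //=.
  by rewrite (@value_get K) //= sD /cur_level -/w le_vw (negbTE neq_wp) minnE.
- rewrite sP => /eqP eq_wp; apply: wp_assign => //=.
  apply: wp_assign => //= fr; apply: HQ => //=.
  move: eq_wp; rewrite -leqn0 leqNgt dist_ord negbK => eq_wp.
  by rewrite sD /cur_level -/w le_vw eq_wp minnE.
Qed.

Lemma wp_clear_counts s d (Q : nat -> state -> Prop) :
  regs s 1 = K -> regs s rE = d.+1 -> d <= n ->
  (forall t s', t <= 40 * d + 50 ->
     agree [:: 8] (memory s) (memory s') ->
     (forall x, x <= d -> tab K (memory s') 8 x = 0) ->
     (forall r, ~~ writes clear_counts r -> regs s' r = regs s r) -> Q t s') ->
  wp W clear_counts s Q.
Proof.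
move=> sK sE dn HQ; have Kn := K_gt; apply: wp_regs.
pose I k t s' := [/\ t <= 40 * k, agree [:: 8] (memory s) (memory s')
  & forall x, x < k -> tab K (memory s') 8 x = 0].
apply: (@wp_for W rJ rE _ d.+1 I) => //; [lia|lia| |].
- move=> k t s1 lt_k s1J fr [le_t a0 z0].
  have s1K : regs s1 1 = K by rewrite fr.
  apply: (@wp_put W K) => //=; [lia|lia|].
  rewrite s1J; split=> /=; first by rewrite cost_addr /=; lia.
    by apply: agree_set => //; lia.
  move=> x xk; rewrite tab_set /=; try lia.
  by case: eqVneq => // neq_xk; apply: z0; lia.
- by move=> t s1 _ [le_t a0 z0] fr; apply: HQ => //; lia.
Qed.

Lemma wp_count_levels s v p (g : 'I_n -> nat) (Q : nat -> state -> Prop) :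
  regs s 1 = K -> graph_tab (memory s) -> regs s rO = (block_addr adj v).+1 ->
  regs s rD = deg e v -> regs s rP = p ->
  (forall x, x <= deg e v -> tab K (memory s) 8 x = 0) ->
  (forall w, cur_level (memory s) (regs s rU) v p w = g w) ->
  (forall t s', t <= 150 * deg e v + 6 ->
     agree [:: 8] (memory s) (memory s') ->
     (forall x, x <= deg e v ->
        tab K (memory s') 8 x = nbr_count e v (fun w => g w == x)) ->
     (forall r, ~~ writes count_levels r -> regs s' r = regs s r) -> Q t s') ->
  wp W count_levels s Q.
Proof.
move=> sK gs sO sD sP z0 gE HQ; have Kn := K_gt; have dv := deg_le v.
apply: wp_regs.
pose I k t s' := [/\ t <= 150 * k, agree [:: 8] (memory s) (memory s')
  & forall x, x <= deg e v ->
      tab K (memory s') 8 x = count (fun w => g w == x) (take k (adj v))].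
apply: (@wp_for W rJ rD _ (deg e v) I) => //; [lia|lia| | |].
- by split=> // x xd; rewrite take0 /= z0.
- move=> k t s1 lt_k s1J fr [le_t a0 cnt].
  have s1K : regs s1 1 = K by rewrite fr.
  apply/wp_seq/(@wp_read_level _ v p k) => //; rewrite ?fr //.
    exact: agree_graph a0 _ gs.
  set w := nth v (adj v) k => t2 s2 le_t2 m2 _ s2Y fr2.
  have {}s2Y : regs s2 rY = g w.
    by rewrite s2Y -gE /cur_level a0 // ord_lt.
  have gd : g w <= deg e v by rewrite -gE /cur_level; case: ifP => // _; lia.
  have s2K : regs s2 1 = K by rewrite fr2.
  have cnt_le : tab K (memory s1) 8 (g w) <= deg e v.
    rewrite cnt // -size_adj; apply: leq_trans (count_size _ _) _.
    by rewrite size_take_min geq_minr.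
  apply: (@wp_put W K) => //; rewrite /= ?fits_get ?(@value_get K) /= ?s2Y ?s2K ?m2; try lia.
  split=> /=; first by rewrite cost_addr cost_get /=; lia.
    by apply: agree_set => //; lia.
  move=> x xd; rewrite tab_set /=; try lia.
  rewrite (take_nth v) ?size_adj // -cats1 count_cat /= -/w addn0 -cnt // eq_sym.
  by case: eqVneq => [->|]; rewrite ?addn0.
- move=> t s1 _ [le_t a0 cnt] fr; apply: HQ => //; first by lia.
  by move=> x xd; rewrite cnt // -size_adj take_size count_adj.
Qed.

(** The elements of level [x.+1] fill the slots from [grank c x] up to, but excluding,
    [grank c x.+1]; hence the initial pointer in row 9. *)
Lemma wp_compute_rank s v (c : nat -> nat) (Q : nat -> state -> Prop) :
  regs s 1 = K -> regs s rD = deg e v -> regs s rG = 1 -> regs s rL = 0 ->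
  (forall x, x <= deg e v -> tab K (memory s) 8 x = c x) ->
  (forall x, c x <= deg e v) ->
  (forall t s', t <= 150 * deg e v + 6 ->
     agree [:: 9] (memory s) (memory s') ->
     regs s' rG = grank c (deg e v) -> regs s' rL = slack c (deg e v) ->
     tab K (memory s') 9 0 = tab K (memory s) 9 0 ->
     (forall x, x < deg e v -> tab K (memory s') 9 x.+1 = grank c x) ->
     (forall r, ~~ writes compute_rank r -> regs s' r = regs s r) -> Q t s') ->
  wp W compute_rank s Q.
Proof.
move=> sK sD sG sL cnt c_le HQ; have Kn := K_gt; have dv := deg_le v.
apply: wp_regs.
pose I k t s' := [/\ t <= 150 * k, agree [:: 9] (memory s) (memory s'),
     regs s' rG = grank c k /\ regs s' rL = slack c k,
     tab K (memory s') 9 0 = tab K (memory s) 9 0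
   & forall x, x < k -> tab K (memory s') 9 x.+1 = grank c x].
apply: (@wp_for W rJ rD _ (deg e v) I) => //; [lia|lia| |].
- move=> k t s1 lt_k s1J fr [le_t a0 [s1G s1L] p0 ptr].
  have s1K : regs s1 1 = K by rewrite fr.
  have rk_le := grank_le c k; have ck := c_le k.+1.
  apply/wp_seq/(@wp_put W K) => //=; rewrite ?s1J; try lia.
  rewrite addn1 s1G; set m2 := set_tab _ _ _ _ _.
  have a2 : agree [:: 9] (memory s) m2 by apply: agree_set => //; lia.
  have m2p : forall x, x < k.+1 -> tab K m2 9 x.+1 = grank c x.
    move=> x xk; rewrite tab_set /=; try lia.
    by case: eqVneq => [[->]//|neq_xk]; apply: ptr; lia.
  have m2z : tab K m2 9 0 = tab K (memory s) 9 0 by rewrite tab_set //=; lia.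
  have m2c : tab K m2 8 k.+1 = c k.+1 by rewrite a2 ?cnt //; lia.
  have get_c : value (State (regs s1) m2) (get 8 (Plus (Reg rJ) (Lit 1))) = c k.+1.
    by rewrite (@value_get K) //= s1J addn1.
  apply/wp_seq/wp_assign.
    by rewrite /= get_c fits_get /= s1J s1K s1G; lia.
  rewrite /= get_c s1G; apply: wp_if => /=; first by lia.
  + rewrite s1J => gt0; apply/wp_seq/wp_assign; rewrite /= ?s1J; try lia.
    apply: wp_assign; rewrite /= ?s1J; try lia.
    split=> //=; first by rewrite !cost_addr !cost_get /=; lia.
    by rewrite /minn; case: ifP => ?; split; lia.
  + rewrite s1J => eq0; apply: wp_skip.
    split=> //=; first by rewrite !cost_addr !cost_get /=; lia.
    by rewrite /minn; case: ifP => ?; split; lia.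
- by move=> t s1 _ [le_t a0 [sG1 sL1] p0 ptr] fr; apply: HQ => //; lia.
Qed.

(** * The invariant for distributing messages and slots *)

Section Sent.
Variables (v p : 'I_n) (g : 'I_n -> nat) (m0 : nat -> nat).
Let d := deg e v.
Let c i := nbr_count e v (fun w => g w == i).

(* State of [send_messages] after the neighbours in [T], from memory [m0]. *)
Definition sent (T : seq 'I_n) m : Prop :=
  [/\ agree [:: 5; 7; 9] m0 m,
      forall u : 'I_n, tab K m 5 u =
        if (u \in T) && (u != p) then rank e v g - (slack c d < g u) else tab K m0 5 u,
      forall u : 'I_n, if (u \in T) && (u != p) then is_true (0 < tab K m 7 u <= maxn 1 (g u))
        else tab K m 7 u = tab K m0 7 u,
      tab K m 9 0 = 1 /\ forall x, x < d ->
        tab K m 9 x.+1 = minn x.+2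
          (grank c x + count (fun w => (w != p) && (g w == x.+1)) T)
    & forall x i, x < d -> grank c x <= i < tab K m 9 x.+1 ->
        exists w : 'I_n, [/\ w \in T, w != p, g w = x.+1 & tab K m 7 w = i]].

Lemma sent_skip T m : sent T m -> sent (rcons T p) m.
Proof.
have memT u : (u \in rcons T p) && (u != p) = (u \in T) && (u != p).
  by rewrite mem_rcons inE; case: eqVneq; rewrite ?andbF.
case=> a m5 m7 [m90 m9] slots; split=> //.
- by move=> u; rewrite memT.
- by move=> u; rewrite memT; apply: m7.
- split=> // x xd; rewrite m9 // -cats1 count_cat /= eqxx /= !addn0 //.
- move=> x i xd /(slots x i xd)[w [wT wp gw w7]]; exists w; split=> //.
  by rewrite mem_rcons inE wT orbT.
Qed.

Let set_msg w m := set_tab K m 5 w (rank e v g - (slack c d < g w)).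

(** A pointer above [g w] means that every slot open to this level is taken, so the truncated
    pointer stays correct when [w] is counted and put into part 1. *)
Lemma sent_full T w m : w \notin T -> w != p -> g w <= d -> d < K ->
  g w < tab K m 9 (g w) -> sent T m ->
  sent (rcons T w) (set_tab K (set_msg w m) 7 w 1).
Proof.
move=> wT np gd dK full [a m5 m7 [m90 m9] slots]; have wK := ord_lt.
have m'9 x : x < K -> tab K (set_tab K (set_msg w m) 7 w 1) 9 x = tab K m 9 x.
  by move=> xK; rewrite !tab_set.
split.
- by do 2![apply: agree_set => //].
- move=> u; rewrite !tab_set //= mem_rcons inE (inj_eq val_inj).
  by case: eqVneq => [->|nuw] //=; rewrite np.
- move=> u; rewrite !tab_set //= mem_rcons inE (inj_eq val_inj).
  by case: eqVneq => [->|nuw] /=; [rewrite np leq_maxl|apply: m7].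
- split=> [|x xd]; first by rewrite m'9 //; lia.
  rewrite m'9; last lia.
  rewrite m9 // -cats1 count_cat /= addn0 np /=.
  case: eqVneq => [gw|]; rewrite ?addn0 //.
  by move: full; rewrite gw m9 //; lia.
- move=> x i xd; rewrite m'9; last lia.
  move/(slots x i xd) => [u [uT up gu u7]]; exists u; split=> //.
    by rewrite mem_rcons inE uT orbT.
  rewrite !tab_set //= (inj_eq val_inj).
  by case: eqVneq uT => // ->; rewrite (negbTE wT).
Qed.

Lemma sent_slot T w m : w \notin T -> w != p -> g w <= d -> d < K ->
  tab K m 9 (g w) <= g w -> sent T m ->
  sent (rcons T w) (set_tab K (set_tab K (set_msg w m) 7 w (tab K m 9 (g w)))
    9 (g w) (tab K m 9 (g w)).+1).
Proof.
move=> wT np gd dK room [a m5 m7 [m90 m9] slots]; have wK := ord_lt.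
have gK : g w < K by lia.
have gw_gt0 : 0 < g w by case: (g w) room => //; rewrite m90.
set m' := set_tab _ _ _ _ _.
have m'9 x : x < K -> tab K m' 9 x =
    if x == g w then (tab K m 9 (g w)).+1 else tab K m 9 x.
  by move=> xK; rewrite !tab_set.
have m'7 (u : 'I_n) : tab K m' 7 u = if u == w then tab K m 9 (g w) else tab K m 7 u.
  by rewrite !tab_set //= (inj_eq val_inj).
have slot_w : tab K m 9 (g w) = grank c (g w).-1 +
    count (fun u => (u != p) && (g u == g w)) T.
  by move: room; rewrite -(prednK gw_gt0) m9 /=; lia.
have grank_gt := grank_gt0 c (g w).-1.
split.
- by do 3![apply: agree_set => //].
- move=> u; rewrite !tab_set //= mem_rcons inE (inj_eq val_inj).
  by case: eqVneq => [->|nuw] //=; rewrite np.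
- move=> u; rewrite m'7 mem_rcons inE; case: eqVneq => [->|nuw] //=; last exact: m7.
  by rewrite np; lia.
- split=> [|x xd]; first by rewrite m'9 ?ltn_eqF //; lia.
  rewrite m'9; last lia.
  rewrite -cats1 count_cat /= addn0 np /= eq_sym.
  case: eqVneq => [gw|]; rewrite ?addn0 ?m9 //=.
  by rewrite slot_w gw /= -gw; move: room; rewrite slot_w gw /=; lia.
- move=> x i xd; rewrite m'9; last lia.
  case: eqVneq => [gw|_] i_lt.
    have [ei|ni] := eqVneq i (tab K m 9 (g w)).
      by exists w; rewrite mem_rcons inE m'7 !eqxx np ei gw.
    have [|u [uT up gu u7]] := slots x i xd; first by rewrite gw; lia.
    exists u; split=> //; first by rewrite mem_rcons inE uT orbT.
    by rewrite m'7; case: eqVneq uT => // ->; rewrite (negbTE wT).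
  have [u [uT up gu u7]] := slots x i xd i_lt.
  exists u; split=> //; first by rewrite mem_rcons inE uT orbT.
  by rewrite m'7; case: eqVneq uT => // ->; rewrite (negbTE wT).
Qed.

(** The final pointers are [grank c x.+1], so the intervals served by the successive levels cover
    everything from 1 up to the rank. This uses [g p = 0]: the parent is skipped, and a slot counted
    for it would stay empty. *)
Lemma sent_slots m i : (e v p -> g p = 0) -> sent (adj v) m -> 0 < i < rank e v g ->
  exists w : 'I_n, [/\ e v w, w != p, i <= g w & tab K m 7 w = i].
Proof.
move=> gp [_ _ _ [_ m9] slots] i_rk.
have [x xd i_x] : exists2 x, x < d & grank c x <= i < grank c x.+1.
  move: i_rk; rewrite /rank -/c -/d; elim: (d) => [|d' IHd]; first by rewrite /=; lia.
  have [lt_i|ge_i] := ltnP i (grank c d') => i_rk.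
    by have [|x xd'] := IHd; [lia|exists x => //; apply: ltnW].
  by exists d' => //; lia.
have [|w [wT np gw w7]] := slots x i xd.
  rewrite m9 // (eq_in_count (a2 := fun w => g w == x.+1)).
    by rewrite count_adj.
  move=> w; rewrite mem_adj => vw /=.
  by case: eqVneq vw => // -> /gp ->.
exists w; split=> //; first by rewrite -mem_adj.
by have := grank_le c x.+1; lia.
Qed.

End Sent.

Lemma wp_send_messages s v p (g : 'I_n -> nat) (Q : nat -> state -> Prop) :
  regs s 1 = K -> graph_tab (memory s) -> regs s rO = (block_addr adj v).+1 ->
  regs s rD = deg e v -> regs s rP = p ->
  (forall w, cur_level (memory s) (regs s rU) v p w = g w) ->
  let c := fun x => nbr_count e v (fun w => g w == x) in
  regs s rG = rank e v g -> regs s rL = slack c (deg e v) ->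
  tab K (memory s) 9 0 = 1 ->
  (forall x, x < deg e v -> tab K (memory s) 9 x.+1 = grank c x) ->
  (forall t s', t <= 300 * deg e v + 6 ->
     sent v p g (memory s) (adj v) (memory s') ->
     (forall r, ~~ writes send_messages r -> regs s' r = regs s r) -> Q t s') ->
  wp W send_messages s Q.
Proof.
move=> sK gs sO sD sP gE c sG sL p0 ptr HQ; have Kn := K_gt; have dv := deg_le v.
apply: wp_regs.
pose I k t s' := t <= 300 * k /\ sent v p g (memory s) (take k (adj v)) (memory s').
apply: (@wp_for W rJ rD _ (deg e v) I) => //; [lia|lia| | |].
- split=> //; rewrite take0; split=> //=.
    split=> // x xd; rewrite addn0 ptr //.
    by have := grank_le c x; rewrite -/c; lia.
  by move=> x i xd; rewrite -/c ptr //; lia.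
- move=> k t s1 lt_k s1J fr [le_t sn]; have [a0 _ _ [m90 m9] _] := sn.
  have s1K : regs s1 1 = K by rewrite fr.
  apply/wp_seq/(@wp_read_level _ v p k) => //; rewrite ?fr //.
    exact: agree_graph a0 _ gs.
  set w := nth v (adj v) k => t2 s2 le_t2 m2 s2X s2Y fr2.
  have {}s2Y : regs s2 rY = g w.
    by rewrite s2Y -gE /cur_level a0 // ord_lt.
  have gd : g w <= deg e v by rewrite -gE /cur_level; case: ifP => // _; lia.
  have {}fr2 r : (r != rJ) && (r != rX) && (r != rY) && ~~ writes send_messages r ->
      regs s2 r = regs s r.
    case/andP=> /andP[/andP[rJ' rX'] rY'] nw; rewrite fr2 ?rX' // fr //.
    by apply: contra nw => /= ->; rewrite orbT.
  have s2K : regs s2 1 = K by rewrite fr2.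
  have s2G : regs s2 rG = rank e v g by rewrite fr2.
  have s2L : regs s2 rL = slack c (deg e v) by rewrite fr2.
  have s2P : regs s2 rP = p by rewrite fr2.
  have wK := ord_lt w; have pK := ord_lt p.
  have takeS : take k.+1 (adj v) = rcons (take k (adj v)) w.
    by rewrite (take_nth v) // size_adj.
  have wT : w \notin take k (adj v).
    have [uadj _] := adjP v; have := take_uniq k.+1 uadj.
    by rewrite takeS rcons_uniq => /andP[].
  have rk_le : rank e v g <= (deg e v).+1 by apply: grank_le.
  apply: wp_if; first by rewrite /= s2X s2P; lia.
    rewrite /= s2X s2P dist_ord => np.
    have s_le : tab K (memory s1) 9 (g w) <= (g w).+1.
      by case: (g w) gd => [|x] xd; [rewrite m90|rewrite m9 //; lia].
    apply/wp_seq/wp_assign; rewrite /= ?fits_get ?(@value_get K) //= s2Y ?s2K; first lia.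
    rewrite m2; set s3 := setr _ _ _.
    pose m3 := set_tab K (memory s1) 5 w (rank e v g - (slack c (deg e v) < g w)).
    have le_s3 : tab K m3 9 (g w) = tab K (memory s1) 9 (g w).
      by rewrite tab_set //; lia.
    (* Both ways of writing the message produce the memory [m3]; [f] abstracts the time spent so
       far, so the slot assignment is verified only once. *)
    suff rest (f : nat -> nat) : (forall t4, f t4 <= t + t4 + 180) ->
        wp W (If (Minus (Reg rS) (Reg rY)) (put 7 (Reg rX) (Lit 1))
          (Seq (put 7 (Reg rX) (Reg rS)) (put 9 (Reg rY) (Plus (Reg rS) (Lit 1)))))
        (State (regs s3) m3) (fun t4 s4 => I k.+1 (f t4) s4).
      apply/wp_seq/wp_if => /=; first by [].
      - rewrite s2Y s2L subn_gt0 => lt_L; apply: (@wp_put W K) => //=; rewrite ?s2X; try lia.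
        move: rest; rewrite /m3 s2G lt_L => rest; rewrite m2; apply: rest => t4.
        by rewrite !cost_get !cost_addr /=; lia.
      - rewrite s2Y s2L => ge_L; apply: (@wp_put W K) => //=; rewrite ?s2X; try lia.
        have le_L : slack c (deg e v) < g w = false by lia.
        move: rest; rewrite /m3 s2G le_L subn0 => rest; rewrite m2; apply: rest => t4.
        by rewrite !cost_get !cost_addr /=; lia.
    move=> f_le; apply: wp_if => /=; first by [].
    - rewrite s2Y subn_gt0 => full; apply: (@wp_put W K) => //=; rewrite ?s2X; try lia.
      split; first by apply: leq_trans (f_le _) _; rewrite cost_addr /=; lia.
      by rewrite takeS; apply: sent_full => //; lia.
    - rewrite s2Y => room; apply/wp_seq/(@wp_put W K) => //=; rewrite ?s2X; try lia.
      apply: (@wp_put W K) => //=; rewrite ?s2Y; try lia.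
      split; first by apply: leq_trans (f_le _) _; rewrite !cost_addr /=; lia.
      by rewrite takeS addn1; apply: sent_slot => //; lia.
  rewrite /= s2X s2P => /eqP; rewrite -leqn0 leqNgt dist_ord negbK => /eqP eq_wp.
  apply: wp_skip; split; first by lia.
  by rewrite m2 takeS eq_wp; apply: sent_skip.
- move=> t s1 _ [le_t sn] fr; apply: HQ => //; first lia.
  by rewrite -size_adj take_size in sn.
Qed.

Definition processed v p (g : 'I_n -> nat) m m' : Prop :=
  [/\ agree [:: 5; 6; 7; 8; 9] m m',
      forall u : 'I_n, tab K m' 6 u = if u == v then rank e v g else tab K m 6 u,
      forall u : 'I_n, tab K m' 5 u = if e v u && (u != p) then
        rank e v g - (slack (fun x => nbr_count e v (fun w => g w == x)) (deg e v) < g u)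
        else tab K m 5 u,
      forall u : 'I_n, if e v u && (u != p)
        then is_true (0 < tab K m' 7 u <= maxn 1 (g u))
        else tab K m' 7 u = tab K m 7 u
    & (e v p -> g p = 0) -> forall i, 0 < i < rank e v g ->
      exists w : 'I_n, [/\ e v w, w != p, i <= g w & tab K m' 7 w = i]].

Lemma wp_process s v p (Q : nat -> state -> Prop) :
  regs s 1 = K -> graph_tab (memory s) -> regs s rV = v -> tab K (memory s) 3 v = p ->
  (forall t s', t <= 1000 * (deg e v).+1 ->
     processed v p (cur_level (memory s) (tab K (memory s) 5 v) v p)
       (memory s) (memory s') ->
     (forall r, ~~ writes process r -> regs s' r = regs s r) -> Q t s') ->
  wp W process s Q.
Proof.
move=> sK gs sV m3 HQ; have Kn := K_gt; have dv := deg_le v; have vK := ord_lt v.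
have ord_K := ord_lt; have [g1 g2 _] := gs; have blk := block_lt v.
set g := cur_level _ _ _ _ in HQ.
apply: wp_regs.
have get_fits s1 j : j < 10 -> regs s1 1 = K -> regs s1 rV = v ->
    fits W s1 (get j (Reg rV)).
  by move=> j10 s1K s1V; rewrite fits_get /= s1K s1V; nia.
apply/wp_seq/wp_assign; rewrite ?get_fits // (@value_get K) //= sV g1.
apply/wp_seq/wp_assign; rewrite ?get_fits // (@value_get K) //= sV g2.
apply/wp_seq/wp_assign; rewrite ?get_fits // (@value_get K) //= sV m3.
apply/wp_seq/wp_assign; rewrite ?get_fits // (@value_get K) //= sV.
apply/wp_seq/wp_assign => /=; first lia.
rewrite addn1; set s1 := setr _ rE _.
apply/wp_seq/(@wp_clear_counts s1 (deg e v)) => // t2 s2 le_t2 a2 z2 fr2.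
rewrite {}/s1 /= in a2 fr2; have s2K : regs s2 1 = K by rewrite fr2.
apply/wp_seq/(@wp_put W K) => //=; try lia.
set m3' := set_tab _ _ _ _ _; set s3 := State _ _.
have a3 : agree [:: 8; 9] (memory s) m3'.
  by apply: agree_set; [lia| |apply: agree_sub a2 => x; rewrite !inE => ->].
have gE w : cur_level m3' (tab K (memory s) 5 v) v p w = g w.
  by rewrite /g /cur_level a3.
apply/wp_seq/(@wp_count_levels s3 v p g); rewrite /= ?fr2 //=.
- exact: agree_graph a3 _ gs.
- by move=> x xd; rewrite tab_set ?z2 //; lia.
move=> t4 s4 le_t4 a4 cnt4 fr4.
apply/wp_seq/wp_assign => /=; first lia.
apply/wp_seq/wp_assign => /=; first lia.
set s5 := setr _ rL _; apply/wp_seq.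
apply: (@wp_compute_rank s5 v (fun x => nbr_count e v (fun w => g w == x))) => //=.
- by rewrite fr4 //= fr2.
- by rewrite fr4 //= fr2.
- by move=> x; apply: nbr_count_le.
rewrite -/s5 => t6 s6 le_t6 a6 s6G s6L p6 ptr6 fr6.
have a46 : agree [:: 8; 9] (memory s) (memory s6).
  apply: agree_trans a3 (agree_trans _ _).
    by apply: agree_sub a4 => x; rewrite !inE => ->.
  by apply: agree_sub a6 => x; rewrite !inE => ->; rewrite orbT.
have s6U : regs s6 rU = tab K (memory s) 5 v by rewrite fr6 //= fr4 //= fr2.
have g6 w : cur_level (memory s6) (regs s6 rU) v p w = g w.
  by rewrite /g /cur_level s6U a46.
apply/wp_seq/(@wp_send_messages s6 v p g) => //.
- by rewrite fr6 //= fr4 //= fr2.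
- exact: agree_graph a46 _ gs.
- by rewrite fr6 //= fr4 //= fr2.
- by rewrite fr6 //= fr4 //= fr2.
- by rewrite fr6 //= fr4 //= fr2.
- by rewrite p6 /= a4 ?tab_set //; lia.
move=> t7 s7 le_t7 sn fr7; have [a7 m75 m77 _ _] := sn.
have s7K : regs s7 1 = K by rewrite fr7 //= fr6 //= fr4 //= fr2.
have s7V : regs s7 rV = v by rewrite fr7 //= fr6 //= fr4 //= fr2.
have s7G : regs s7 rG = rank e v g by rewrite fr7.
apply: (@wp_put W K) => //=; rewrite s7V; first lia.
move=> fr; apply: HQ => //.
  by rewrite !cost_get !cost_addr /=; lia.
rewrite s7G; have row j x : x < K -> j != 6 ->
    tab K (set_tab K (memory s7) 6 v (rank e v g)) j x = tab K (memory s7) j x.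
  by move=> xK /negbTE nj; rewrite tab_set // nj.
split.
- move=> j x xK; rewrite !inE !negb_or => /and5P[j5 j6 j7 j8 j9].
  by rewrite row // a7 ?a46 // !inE !negb_or ?j5 ?j7 ?j8 ?j9.
- move=> u; rewrite tab_set //= (inj_eq val_inj); case: eqVneq => // _.
  by rewrite a7 ?a46.
- by move=> u; rewrite row // m75 mem_adj a46.
- by move=> u; rewrite row //; have := m77 u; rewrite mem_adj a46.
- move=> gp i i_rk; have [w [vw np le_i w7]] := sent_slots gp sn i_rk.
  by exists w; rewrite row.
Qed.

End Process.

(** * Breadth-first search *)

Definition scan_vertex : cmd :=
  for_loop rJ rD
    (Seq (Assign rX (Mem (Plus (Reg rO) (Reg rJ))))
      (If (dist (Reg rX) (Reg rP))
        (Seq (put 3 (Reg rX) (Reg rV))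
        (Seq (put 5 (Reg rX) (Lit 0))
        (Seq (put 4 (Reg rT) (Reg rX))
          (Assign rT (Plus (Reg rT) (Lit 1))))))
        Skip)).

(* As the graph is a tree, no visited marks are needed: a neighbour other than
   the parent is new. The root is its own parent. *)
Definition bfs : cmd :=
  Seq (put 3 (Reg rR) (Reg rR))
  (Seq (put 4 (Lit 0) (Reg rR))
  (Seq (put 5 (Reg rR) (Lit 0))
  (Seq (Assign rT (Lit 1))
    (for_loop rH rN
      (Seq (Assign rV (get 4 (Reg rH)))
      (Seq (Assign rD (get 1 (Reg rV)))
      (Seq (Assign rO (get 2 (Reg rV)))
      (Seq (Assign rP (get 3 (Reg rV)))
        scan_vertex)))))))).

Section Bfs.
Variables (n : nat) (e : rel 'I_n) (adj : 'I_n -> seq 'I_n) (W : nat).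
Let K := size (encode_graph adj).
Hypotheses (e_simple : simple_graph e) (e_tree : tree e).
Hypotheses (adjP : adjacency_lists e adj) (W_large : 20 * K <= W).

Implicit Types (m : nat -> nat) (s : state) (o : seq 'I_n) (par : 'I_n -> 'I_n).

Let Kn : n < K := K_gt adj.
Let ord_K (v : 'I_n) : v < K := ord_lt adj v.

Definition bfs_tab m o par : Prop :=
  (forall i v, i < size o -> tab K m 4 i = nth v o i) /\
  (forall u : 'I_n, u \in o -> tab K m 3 u = par u /\ tab K m 5 u = 0).

Lemma bfs_tab_add m o par (u v : 'I_n) : bfs_tab m o par -> u \notin o -> size o < K ->
  bfs_tab (set_tab K (set_tab K (set_tab K m 3 u v) 5 u 0) 4 (size o) u)
    (rcons o u) [eta par with u |-> v].
Proof.
case=> m4 m35 uo oK; split=> [i w|w].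
  rewrite size_rcons ltnS => le_i; rewrite tab_set //=; last exact: leq_ltn_trans oK.
  rewrite nth_rcons; case: ltngtP le_i => // lt_i _.
  by rewrite !tab_set //= -?m4 //; exact: ltn_trans oK.
rewrite mem_rcons inE !tab_set //= (inj_eq val_inj) => /orP[/eqP->|wo].
  by rewrite eqxx.
by case: eqVneq wo => [->|_ /m35//]; rewrite (negbTE uo).
Qed.

(** [T] is the finished prefix of the queue and [v] its next entry; new vertices are appended, so
    this prefix never changes. *)
Lemma wp_scan_vertex s (r v : 'I_n) (o T : seq 'I_n) par (Q : nat -> state -> Prop) :
  regs s 1 = K -> graph_tab e adj (memory s) -> regs s rV = v ->
  regs s rD = deg e v -> regs s rO = (block_addr adj v).+1 -> regs s rP = par v ->
  take (size T).+1 o = rcons T v ->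
  scan_inv e r (fun x y => (x \in T) && e x y) o par ->
  regs s rT = size o -> bfs_tab (memory s) o par ->
  (forall t s' o' par', t <= 200 * deg e v + 6 ->
     agree adj [:: 3; 4; 5] (memory s) (memory s') ->
     take (size T).+1 o' = rcons T v ->
     scan_inv e r (fun x y => (x \in rcons T v) && e x y) o' par' ->
     regs s' rT = size o' -> bfs_tab (memory s') o' par' ->
     (forall r, ~~ writes scan_vertex r -> regs s' r = regs s r) -> Q t s') ->
  wp W scan_vertex s Q.
Proof.
move=> sK gs sV sD sO sP Tv_o inv0 sT tab0 HQ; have dv := deg_le e v.
apply: wp_regs.
pose seen k (x y : 'I_n) := (x \in T) && e x y || (x == v) && (y \in take k (adj v)).
pose I k t s' := t <= 200 * k /\ exists o' par', [/\
  agree adj [:: 3; 4; 5] (memory s) (memory s'),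
  take (size T).+1 o' = rcons T v /\ par' v = par v, scan_inv e r (seen k) o' par',
  regs s' rT = size o' & bfs_tab (memory s') o' par'].
apply: (@wp_for W rJ rD _ (deg e v) I) => //; [lia|lia| | |].
- split=> //; exists o, par; split=> //; apply: eq_scan_inv inv0 => x y.
  by rewrite /seen take0 in_nil andbF orbF.
- move=> k t s1 lt_k s1J fr [le_t [o1 [par1 [a1 [o1T par1v] inv1 s1T tab1]]]].
  have s1K : regs s1 1 = K by rewrite fr.
  have s1P : regs s1 rP = par v by rewrite fr.
  have s1V : regs s1 rV = v by rewrite fr.
  have o1_le : size o1 <= n.
    have [[uo1 _ _ _] _ _] := inv1.
    by rewrite -[X in _ <= X]card_ord -(card_uniqP uo1) max_card.
  have vo1 : v \in o1.
    by apply: (@mem_take (size T).+1); rewrite o1T mem_rcons mem_head.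
  set u := nth v (adj v) k.
  have vu : e v u by rewrite -(mem_adj adjP) mem_nth // (size_adj adjP).
  have takeS : take k.+1 (adj v) = rcons (take k (adj v)) u.
    by rewrite (take_nth v) // (size_adj adjP).
  have uT : u \notin take k (adj v).
    have [uadj _] := adjP v; have := take_uniq k.+1 uadj.
    by rewrite takeS rcons_uniq => /andP[].
  have seenS x y : seen k x y || (x == v) && (y == u) = seen k.+1 x y.
    by rewrite /seen takeS mem_rcons inE -orbA -andb_orr [(y == u) || _]orbC.
  have nseen : ~~ seen k v u.
    rewrite /seen eqxx /= (negbTE uT) orbF; apply/nandP; left.
    have [[uo1 _ _ _] _ _] := inv1.
    by have := take_uniq (size T).+1 uo1; rewrite o1T rcons_uniq => /andP[].
  have val_u : memory s1 (regs s1 rO + regs s1 rJ) = u.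
    by rewrite s1J fr // sO (nth_adj adjP) //; apply: agree_graph a1 _ gs.
  have := block_lt adjP v; rewrite -/K => blk.
  apply/wp_seq/wp_assign; first by rewrite /= s1J fr // sO; lia.
  rewrite /= val_u; have uK := ord_K u; have vK := ord_K v; have pK := ord_K (par v).
  apply: wp_if; first by rewrite /= s1P; lia.
    rewrite /= s1P dist_ord => neq_u.
    have [|uo2 inv2] := scan_inv_add e_simple e_tree inv1 vo1 vu _ nseen.
      by rewrite par1v.
    have tab2 := bfs_tab_add v tab1 uo2 (leq_ltn_trans o1_le Kn).
    apply/wp_seq/(@wp_put W K) => //=; first lia.
    apply/wp_seq/(@wp_put W K) => //=; try lia.
    apply/wp_seq/(@wp_put W K) => //=; rewrite ?s1T; try lia.
    apply: wp_assign => /=; rewrite ?s1T; first lia.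
    split; first by rewrite !cost_addr /=; lia.
    exists (rcons o1 u), [eta par1 with u |-> v]; split=> //=.
    + by apply: agree_set; [lia| |do 2![apply: agree_set => //]].
    + split.
        have le_T : (size T).+1 <= size o1.
          by have := congr1 size o1T; rewrite size_take_min size_rcons; lia.
        by rewrite -[rcons o1 u]cats1 (takel_cat _ le_T).
      case: eqVneq => // vE; by move: uo2; rewrite -vE vo1.
    + exact: eq_scan_inv inv2.
    + by rewrite size_rcons addn1.
    + by rewrite s1V.
  rewrite /= s1P => /eqP; rewrite -leqn0 leqNgt dist_ord negbK => /eqP eq_u.
  apply: wp_skip; split=> /=; first lia.
  exists o1, par1; split=> //.
  apply: eq_scan_inv (scan_inv_skip inv1 vo1) => x y.
  by rewrite -seenS par1v eq_u.
- move=> t s1 _ [le_t [o1 [par1 [a1 [o1T par1v] inv1 s1T tab1]]]] fr.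
  apply: (HQ _ s1 o1 par1) => //; first lia.
  apply: eq_scan_inv inv1 => x y; rewrite /seen -(size_adj adjP) take_size (mem_adj adjP).
  rewrite mem_rcons inE; case: eqVneq => [->|] /=; last by rewrite orbF.
  by rewrite orbC; case: (e v y); rewrite ?andbF.
Qed.

Lemma wp_bfs s (r : 'I_n) (Q : nat -> state -> Prop) :
  regs s rN = n -> regs s 1 = K -> graph_tab e adj (memory s) -> regs s rR = r ->
  (forall t s' o par, t <= 1000 * (n + \sum_v deg e v) ->
     agree adj [:: 3; 4; 5] (memory s) (memory s') ->
     rooted e r o par -> (forall v, v \in o) -> bfs_tab (memory s') o par ->
     (forall r, ~~ writes bfs r -> regs s' r = regs s r) -> Q t s') ->
  wp W bfs s Q.
Proof.
move=> sN sK gs sR HQ; have rK := ord_K r; have n_gt0 : 0 < n by have := ltn_ord r; lia.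
apply: wp_regs.
apply/wp_seq/(@wp_put W K) => //=; rewrite ?sR; try lia.
apply/wp_seq/(@wp_put W K) => //=; rewrite ?sR; try lia.
apply/wp_seq/(@wp_put W K) => //=; rewrite ?sR; try lia.
apply/wp_seq/wp_assign => /=; first lia.
set m1 := set_tab _ _ 5 _ _; set s1 := setr _ _ _.
have a1 : agree adj [:: 3; 4; 5] (memory s) m1.
  by apply: agree_set => //; apply: agree_set; [lia| |apply: agree_set].
pose I h t s' := exists o par, [/\
  t <= 500 * h + 500 * \sum_(v <- take h o) deg e v,
  agree adj [:: 3; 4; 5] (memory s) (memory s'),
  scan_inv e r (fun x y => (x \in take h o) && e x y) o par,
  regs s' rT = size o & bfs_tab (memory s') o par].
have size_le h o par : scan_inv e r (fun x y => (x \in take h o) && e x y) o par ->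
    size o <= n /\ (size o <= h -> forall v, v \in o).
  move=> inv; have [[uo _ _ _] _ _] := inv; split.
    by rewrite -[X in _ <= X]card_ord -(card_uniqP uo) max_card.
  by move=> le_h v; apply: scan_inv_all inv _ _ => // x y xo xy; rewrite take_oversize // xo.
apply: (@wp_for W rH rN _ n I) => //; [lia|lia| | |].
- exists [:: r], (fun=> r); split=> //=.
    exact: scan_inv_start.
  split=> [[|i] v //= _|u]; first by rewrite !tab_set //; lia.
  by rewrite inE => /eqP->; rewrite !tab_set //= ?eqxx //; lia.
- move=> h t s2 lt_h s2H fr [o [par [le_t a2 inv s2T tab2]]].
  have [o_le o_all] := size_le h o par inv.
  (* The queue cannot run dry early: once all its entries are scanned it contains all [n] vertices,
     but only [h < n] have been scanned. *)
  have lt_ho : h < size o.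
    rewrite ltnNge; apply/negP => le_oh; have := o_all le_oh => all_o.
    have : n <= size o.
      rewrite -[X in X <= _]card_ord; apply: leq_trans (card_size o).
      by apply: subset_leq_card; apply/subsetP => x _; apply: all_o.
    lia.
  have s2K : regs s2 1 = K by rewrite fr.
  set v := nth r o h; have vK := ord_K v; have [tab2o tab2u] := tab2.
  have vo : v \in o by apply: mem_nth.
  have g2 : graph_tab e adj (memory s2) by apply: agree_graph a2 _ gs.
  have [g21 g22 _] := g2; have [par_v _] := tab2u v vo.
  have T_size : size (take h o) = h by rewrite size_takel // ltnW.
  apply/wp_seq/wp_assign; first by rewrite fits_get /= s2H s2K; lia.
  rewrite (@value_get K) //= s2H (tab2o h r) // -/v.
  apply/wp_seq/wp_assign; first by rewrite fits_get /= s2K; lia.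
  rewrite (@value_get K) //= g21.
  apply/wp_seq/wp_assign; first by rewrite fits_get /= s2K; lia.
  rewrite (@value_get K) //= g22.
  apply/wp_seq/wp_assign; first by rewrite fits_get /= s2K; lia.
  rewrite (@value_get K) //= par_v.
  apply: (@wp_scan_vertex _ r v o (take h o) par) => //=.
    by rewrite T_size (take_nth r).
  rewrite T_size => t3 s3 o3 par3 le_t3 a3 o3T inv3 s3T tab3 fr3.
  exists o3, par3; split=> //.
  + rewrite o3T -cats1 big_cat big_seq1 /= !cost_get /=.
    by move: le_t; set S := (\sum_(_ <- _) _); lia.
  + exact: agree_trans a2 a3.
  + by rewrite o3T.
- move=> t s2 fr [o [par [le_t a2 inv s2T tab2]]] fr2.
  have [o_le o_all] := size_le n o par inv; have [rt _ _] := inv.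
  have [uo _ _ _] := rt.
  apply: (HQ _ s2 o par) => //; last exact: o_all.
  rewrite take_oversize // big_uniq //= in le_t.
  have eq_sum : \sum_(v in o) deg e v = \sum_v deg e v.
    by apply: eq_bigl => v; rewrite o_all.
  rewrite eq_sum in le_t; rewrite !cost_addr /=.
  by move: le_t; set S := (\sum_v deg e v); lia.
Qed.

End Bfs.

(** * Sweeps *)

Definition sweep_up : cmd :=
  for_loop rI rN
    (Seq (Assign rV (get 4 (Minus (Minus (Reg rN) (Lit 1)) (Reg rI)))) process).

Definition sweep_down : cmd :=
  for_loop rI rN (Seq (Assign rV (get 4 (Reg rI))) process).

Section Sweeps.
Variables (n : nat) (e : rel 'I_n) (adj : 'I_n -> seq 'I_n) (W : nat).
Let K := size (encode_graph adj).
Hypotheses (e_simple : simple_graph e) (e_tree : tree e).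
Hypotheses (adjP : adjacency_lists e adj) (W_large : 20 * K <= W).
Variable M : 'I_n -> 'I_n -> nat.
Hypothesis ME : messages e M.

Implicit Types (m : nat -> nat) (s : state) (o : seq 'I_n) (par : 'I_n -> 'I_n).

Let Kn : n < K := K_gt adj.
Let ord_K (v : 'I_n) : v < K := ord_lt adj v.

Lemma size_all o : uniq o -> (forall v, v \in o) -> size o = n.
Proof.
move=> uo all_o; rewrite -[RHS]card_ord -(card_uniqP uo).
by apply: eq_card => v; rewrite all_o.
Qed.

Lemma sum_all o : uniq o -> (forall v, v \in o) ->
  \sum_(v <- o) (deg e v).+1 = \sum_v (deg e v).+1.
Proof. by move=> uo all_o; rewrite big_uniq //; apply: eq_bigl => v; rewrite all_o. Qed.

(** Children are processed before [v], so their row 6 is final. Row 5 of [v] is still 0, because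
    only the parent writes it and comes later; the parent thus has level 0 and the computed rank is
    [M v (par v)]. *)
Lemma wp_sweep_up s r o par (Q : nat -> state -> Prop) :
  regs s rN = n -> regs s 1 = K -> graph_tab e adj (memory s) ->
  rooted e r o par -> (forall v, v \in o) -> bfs_tab adj (memory s) o par ->
  (forall t s', t <= 100 * n.+1 + 1000 * \sum_v (deg e v).+1 ->
     agree adj [:: 5; 6; 7; 8; 9] (memory s) (memory s') ->
     (forall v : 'I_n, tab K (memory s') 6 v = M v (par v)) ->
     (forall v : 'I_n, v != r -> 0 < tab K (memory s') 7 v <= maxn 1 (M v (par v))) ->
     (forall (v : 'I_n) i, 0 < i < M v (par v) -> exists w : 'I_n,
        [/\ e v w, w != par v, deg e v <= deg e w & tab K (memory s') 7 w = i]) ->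
     (forall x, ~~ writes sweep_up x -> regs s' x = regs s x) -> Q t s') ->
  wp W sweep_up s Q.
Proof.
move=> sN sK gs rt all_o [ord_o par_o] HQ; have [uo _ parr parP] := rt.
have so := size_all uo all_o; have n_gt0 : 0 < n by have := ltn_ord r; lia.
apply: wp_regs.
pose P k := drop (n - k) o.
pose I k t s' := [/\ t <= 100 * k + 1000 * \sum_(v <- P k) (deg e v).+1,
   agree adj [:: 5; 6; 7; 8; 9] (memory s) (memory s'),
   forall v : 'I_n, if v \in P k then tab K (memory s') 6 v = M v (par v)
     else tab K (memory s') 5 v = 0,
   forall u : 'I_n, u != r -> par u \in P k ->
     0 < tab K (memory s') 7 u <= maxn 1 (M u (par u))
 & forall (v : 'I_n) i, v \in P k -> 0 < i < M v (par v) -> exists w : 'I_n,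
        [/\ e v w, w != par v, deg e v <= deg e w & tab K (memory s') 7 w = i]].
apply: (@wp_for W rI rN _ n I) => //; [lia|lia| | |].
- have P0 : P 0 = [::] by rewrite /P subn0 drop_oversize ?so.
  by rewrite /I P0 big_nil; split=> // v; have [] := par_o v (all_o v).
- move=> k t s1 lt_k s1I fr [le_t a1 dU f_par slots].
  have s1K : regs s1 1 = K by rewrite fr.
  have s1N : regs s1 rN = n by rewrite fr.
  have lt_idx : n - 1 - k < size o by lia.
  set v := nth r o (n - 1 - k); have vK := ord_K v.
  have PS : P k.+1 = v :: P k.
    rewrite /P (_ : n - k.+1 = n - 1 - k); last lia.
    by rewrite (drop_nth r) //; congr (_ :: drop _ _); lia.
  have mem_P u : (u \in P k) = (n - k <= index u o).
    have := uo; rewrite -{1}(cat_take_drop (n - k) o) cat_uniq => /and3P[_ /hasPn dis _].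
    have := all_o u; rewrite -{1}(cat_take_drop (n - k) o) mem_cat leqNgt -in_take //.
    by have := dis u; case: (u \in drop _ _) => [/(_ isT)/negbTE->|_ /orP[->|]].
  have idx_v : index v o = n - 1 - k by rewrite index_uniq.
  have child_P u : e v u -> u != par v -> [/\ par u = v, u != r, u \in P k & u != v].
    move=> vu nu; have [pu ur] := child e_simple e_tree rt all_o vu nu.
    rewrite -[index v _]/(index v o) -[index u _]/(index u o) => lt_i.
    split=> //; first by rewrite mem_P; lia.
    by apply: contraTneq lt_i => ->; rewrite ltnn.
  have vP : v \notin P k by rewrite mem_P idx_v; lia.
  have par3 (u : 'I_n) : tab K (memory s1) 3 u = par u.
    by rewrite a1 //; have [] := par_o u (all_o u).
  have U0 : tab K (memory s1) 5 v = 0 by have := dU v; rewrite (negbTE vP).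
  have val_v : value s1 (get 4 (Minus (Minus (Reg rN) (Lit 1)) (Reg rI))) = v.
    by rewrite (@value_get K) //= s1N s1I a1 ?(ord_o _ r) //; lia.
  apply/wp_seq/wp_assign; first by rewrite fits_get /= s1K s1N s1I; lia.
  rewrite val_v.
  apply: (@wp_process _ e adj adjP W W_large _ v (par v)) => //=.
    exact: agree_graph a1 _ gs.
  rewrite U0; set g := cur_level _ _ _ _ _ _ => t2 s2 le_t2 [a2 p6 p5 p7 p_slots] fr2.
  have gE u : e v u -> g u = level e M v (par v) u.
    move=> vu; rewrite /g /cur_level /level; case: eqVneq => [_|nu] /=.
      by rewrite min0n; case: ifP.
    by have [pu _ uP _] := child_P u vu nu; have := dU u; rewrite uP pu => ->.
  have rkE : rank e v g = M v (par v) by rewrite ME; apply: eq_rank.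
  have g_par : g (par v) = 0 by rewrite /g /cur_level eqxx min0n; case: ifP.
  have other7 u : par u != v -> u != r -> tab K (memory s2) 7 u = tab K (memory s1) 7 u.
    move=> npu ur; have := p7 u; case: ifP => // /andP[vu nu].
    by have [pu] := child_P u vu nu; rewrite pu eqxx in npu.
  split.
  + rewrite PS big_cons cost_get /=.
    by move: le_t; set S := (\sum_(_ <- P k) _); lia.
  + exact: agree_trans a1 a2.
  + move=> u; rewrite PS inE p6 p5; case: eqVneq => [->|nuv] /=; first exact: rkE.
    have := dU u; case: ifP => // uP u0; case: ifP => // /andP[vu nu].
    by have [_ _] := child_P u vu nu; rewrite uP.
  + move=> u ur; rewrite PS inE => /orP[/eqP pu|pP]; last first.
      rewrite other7 //; first exact: f_par.
      by apply: contraTneq pP => ->.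
    (* A child [u] of [v] is not the parent of [v], since each would then precede the other in [o];
       so [process] did assign a part to [u]. *)
    have [_ _ pe] := parP u (all_o u) ur; rewrite pu in pe *.
    have nu : u != par v.
      apply/eqP => uE; have [] := parP v (all_o v).
        by apply: contraTneq pe => vr; rewrite uE vr parr; case: e_simple => _ ->.
      have [_ lt1 _] := parP u (all_o u) ur; rewrite pu in lt1.
      by rewrite -uE => _; rewrite ltnNge ltnW.
    have := p7 u; rewrite pe nu /= gE // /level nu /= => /andP[-> le7] /=.
    by apply: leq_trans le7 _; case: ifP => _; lia.
  + move=> x i; rewrite PS inE; case: eqVneq => [->|nxv] /= xP i_lt.
      have [|w [vw nw le_i w7]] := p_slots (fun=> g_par) i; first by rewrite rkE.
      exists w; split=> //; move: le_i; rewrite /g /cur_level.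
      by case: ifP => // _; lia.
    have [w [xw nw dw w7]] := slots x i xP i_lt; exists w; split=> //.
    have [pw wr _] := child e_simple e_tree rt all_o xw nw.
    by rewrite other7 // pw.
- move=> t s1 _ [le_t a1 dU f_par slots] fr.
  have memP v : v \in P n by rewrite /P subnn drop0.
  have PE : P n = o by rewrite /P subnn drop0.
  rewrite PE sum_all // in le_t.
  apply: HQ => //; first by move: le_t; set S := (\sum_v _); lia.
  + by move=> v; have := dU v; rewrite memP.
  + by move=> v vr; apply: f_par.
  + by move=> v i; apply: slots.
Qed.

(** When [v] is processed, its parent has already replaced the stale entry in row 5 by
    [M (par v) v], while the children still hold their upward messages in row 6. All neighbours are
    then taken into account, and the rank is [M v v]. *)
Lemma wp_sweep_down s r o par (Q : nat -> state -> Prop) :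
  regs s rN = n -> regs s 1 = K -> graph_tab e adj (memory s) ->
  rooted e r o par -> (forall v, v \in o) ->
  (forall i v, i < size o -> tab K (memory s) 4 i = nth v o i) ->
  (forall v : 'I_n, tab K (memory s) 3 v = par v) ->
  (forall v : 'I_n, tab K (memory s) 6 v = M v (par v)) ->
  (forall t s', t <= 100 * n.+1 + 1000 * \sum_v (deg e v).+1 ->
     agree adj [:: 5; 6; 7; 8; 9] (memory s) (memory s') ->
     (forall v : 'I_n, tab K (memory s') 6 v = M v v) ->
     (forall x, ~~ writes sweep_down x -> regs s' x = regs s x) -> Q t s') ->
  wp W sweep_down s Q.
Proof.
move=> sN sK gs rt all_o ord_o par_o D0 HQ; have [uo _ parr parP] := rt.
have [_ e_irr] := e_simple.
have so := size_all uo all_o; have n_gt0 : 0 < n by have := ltn_ord r; lia.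
apply: wp_regs.
pose I k t s' := [/\ t <= 100 * k + 1000 * \sum_(v <- take k o) (deg e v).+1,
   agree adj [:: 5; 6; 7; 8; 9] (memory s) (memory s'),
   forall v : 'I_n, tab K (memory s') 6 v = M v (if index v o < k then v else par v)
 & forall v : 'I_n, v != r -> index (par v) o < k ->
     tab K (memory s') 5 v = M (par v) v].
apply: (@wp_for W rI rN _ n I) => //; [lia|lia| |].
- move=> k t s1 lt_k s1I fr [le_t a1 D1 U1].
  have s1K : regs s1 1 = K by rewrite fr.
  have lt_idx : k < size o by lia.
  set v := nth r o k; have vK := ord_K v.
  have idx_v : index v o = k by rewrite index_uniq.
  have idx_neq u : u != v -> (index u o == k) = false.
    by rewrite -idx_v => nuv; apply: contraNF nuv => /eqP/index_inj->.
  have child_P u : e v u -> u != par v -> [/\ par u = v, u != r & k < index u o].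
    by move=> vu nu; have [pu ur] := child e_simple e_tree rt all_o vu nu; rewrite idx_v.
  have val_v : value s1 (get 4 (Reg rI)) = v.
    by rewrite (@value_get K) //= s1I a1 ?(ord_o _ r) //; lia.
  apply/wp_seq/wp_assign; first by rewrite fits_get /= s1K s1I; lia.
  rewrite val_v.
  apply: (@wp_process _ e adj adjP W W_large _ v (par v)) => //=.
  + exact: agree_graph a1 _ gs.
  + by rewrite a1.
  set g := cur_level _ _ _ _ _ _ => t2 s2 le_t2 [a2 p6 p5 _ _] fr2.
  have gE u : e v u -> g u = level e M v v u.
    move=> vu; rewrite /g /cur_level /level.
    have -> : u != v by apply: contraTneq vu => ->; rewrite e_irr.
    case: eqVneq => [uE|nu] /=.
      rewrite uE in vu *; have [vr lt_i] := parent e_simple rt (all_o v) vu.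
      by rewrite U1 // -idx_v.
    have [pu _ lt_i] := child_P u vu nu.
    have idx_u : (index u o < k) = false by rewrite ltnNge ltnW.
    by rewrite D1 idx_u pu.
  have rkE : rank e v g = M v v by rewrite ME; apply: eq_rank.
  split.
  + rewrite (take_nth r) // -cats1 big_cat big_seq1 -/v cost_get /=.
    by move: le_t; set S := (\sum_(_ <- take k o) _); lia.
  + exact: agree_trans a1 a2.
  + move=> u; rewrite p6 rkE; case: eqVneq => [->|nuv].
      by rewrite idx_v ltnSn.
    by rewrite D1 [index u o < k.+1]ltnS [index u o <= k]leq_eqVlt idx_neq.
  + move=> u ur; rewrite ltnS leq_eqVlt => /orP[/eqP pu|lt_p]; last first.
      rewrite p5; case: ifP => [/andP[vu nu]|_]; last exact: U1.
      by have [pu] := child_P u vu nu; rewrite pu idx_v ltnn in lt_p.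
    have {}pu : par u = v by rewrite -(nth_index r (all_o (par u))) pu.
    have [_ lt_pu pe] := parP u (all_o u) ur; rewrite pu in pe lt_pu *.
    have nu : u != par v.
      apply/eqP => uE; have vp : e v (par v) by rewrite -uE.
      have [_] := parent e_simple rt (all_o v) vp.
      by rewrite -uE ltnNge ltnW.
    by rewrite p5 pe nu /=; apply/esym/message_excl.
- move=> t s1 _ [le_t a1 D1 _] fr.
  rewrite take_oversize ?so // sum_all // in le_t.
  apply: HQ => //; first by move: le_t; set S := (\sum_v _); lia.
  by move=> v; rewrite D1; have := all_o v; rewrite -index_mem so => ->.
Qed.

End Sweeps.

(** * The whole program *)

Definition next_block : cmd :=
  Assign rA (Plus (Plus (Reg rA) (Mem (Reg rA))) (Lit 1)).

(** The row length is the input size, so that row 1 starts just behind the input. It is known only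
    after a first pass over the blocks, and the table is filled in a second pass. *)
Definition load : cmd :=
  Seq (Assign rN (Mem (Lit 0)))
  (Seq (Assign rA (Lit 1))
  (Seq (for_loop rI rN next_block)
  (Seq (Assign 1 (Reg rA))
  (Seq (Assign rA (Lit 1))
    (for_loop rI rN
      (Seq (put 1 (Reg rI) (Mem (Reg rA)))
      (Seq (put 2 (Reg rI) (Plus (Reg rA) (Lit 1)))
        next_block))))))).

Definition find_max : cmd :=
  Seq (Assign rB (Lit 0))
  (Seq (Assign rR (Lit 0))
    (for_loop rI rN
      (If (Minus (get 6 (Reg rI)) (Reg rB))
        (Seq (Assign rB (get 6 (Reg rI))) (Assign rR (Reg rI)))
        Skip))).

(** The root receives no slot from a parent; its part is its own rank, which is also the number of
    parts. *)
Definition output : cmd :=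
  Seq (put 7 (Reg rR) (get 6 (Reg rR)))
  (Seq (for_loop rI rN (put 0 (Plus (Reg rI) (Lit 1)) (get 7 (Reg rI))))
    (put 0 (Lit 0) (get 6 (Reg rR)))).

Definition strong_transitivity_program : cmd :=
  Seq load (Seq (Assign rR (Lit 0)) (Seq bfs (Seq sweep_up (Seq sweep_down
  (Seq find_max (Seq bfs (Seq sweep_up output))))))).

Section Main.
Variables (n : nat) (e : rel 'I_n) (adj : 'I_n -> seq 'I_n).
Let K := size (encode_graph adj).
Hypotheses (e_simple : simple_graph e) (e_tree : tree e).
Hypothesis adjP : adjacency_lists e adj.

Implicit Types (m : nat -> nat) (s : state).

Lemma size_encode : K = (\sum_v (deg e v).+1).+1.
Proof.
rewrite /K /= size_flatten /shape sumnE !big_map -enumT big_enum /=; congr _.+1.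
by apply: eq_bigr => v _; rewrite /= size_map (size_adj adjP).
Qed.

Let Kn : n < K := K_gt adj.
Let ord_K (v : 'I_n) : v < K := ord_lt adj v.

Variable W : nat.
Hypothesis W_large : 20 * K <= W.

Lemma wp_next_block s (v : 'I_n) (Q : nat -> state -> Prop) :
  (forall x, x < K -> memory s x = nth 0 (encode_graph adj) x) ->
  regs s rA = block_addr adj v ->
  Q 7 (setr s rA (block_addr adj v.+1)) -> wp W next_block s Q.
Proof.
move=> m0 sA Qs; have := block_lt adjP v; rewrite -/K => blk.
have mv : memory s (block_addr adj v) = deg e v.
  rewrite m0 ?(leq_ltn_trans _ blk) ?leq_addr // -[block_addr _ _]addn0.
  by rewrite nth_block ?(size_adj adjP).
have bE : block_addr adj v + deg e v + 1 = block_addr adj v.+1.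
  by rewrite block_addr_ord (size_adj adjP) addn1.
by apply: wp_assign; rewrite /= sA mv ?bE //; lia.
Qed.

Lemma wp_load (Q : nat -> state -> Prop) :
  (forall t s', t <= 200 * n.+1 -> regs s' rN = n -> regs s' 1 = K ->
     graph_tab e adj (memory s') -> Q t s') ->
  wp W load (initial_state (encode_graph adj)) Q.
Proof.
move=> HQ; set s0 := initial_state _.
have b0 : block_addr adj 0 = 1 by rewrite /block_addr take0.
apply/wp_seq/wp_assign => /=; first lia.
apply/wp_seq/wp_assign => /=; first lia.
set s1 := setr _ _ _; apply/wp_seq.
pose I1 k t s := [/\ t <= 50 * k, regs s rA = block_addr adj k & memory s = memory s0].
apply: (@wp_for W rI rN _ n I1) => //; [lia|lia| |].
  move=> k t s lt_k _ fr [le_t sA sm].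
  apply: (@wp_next_block _ (Ordinal lt_k)) => //; first by rewrite sm.
  by split=> //; lia.
move=> t2 s2 fr2 [le_t2 s2A s2m]; have {fr2}s2N : regs s2 rN = n by rewrite fr2.
apply/wp_seq/wp_assign => //=; apply/wp_seq/wp_assign => /=; first lia.
rewrite s2A block_addr_end -/K; set s3 := setr _ _ _.
pose I2 k t s := [/\ t <= 100 * k, regs s rA = block_addr adj k,
  forall v : 'I_n, v < k ->
    tab K (memory s) 1 v = deg e v /\ tab K (memory s) 2 v = (block_addr adj v).+1
  & forall x, x < K -> memory s x = nth 0 (encode_graph adj) x].
apply: (@wp_for W rI rN _ n I2) => //; [lia|lia| | |].
- by split=> // x _; rewrite /= s2m.
- move=> k t s lt_k sI fr [le_t sA tab_v m0]; pose v := Ordinal lt_k.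
  have sK : regs s 1 = K by rewrite fr.
  have := block_lt adjP v; rewrite -/K /= => blk.
  have mv : memory s (block_addr adj v) = deg e v.
    rewrite m0 ?(leq_ltn_trans _ blk) ?leq_addr // -[block_addr _ _]addn0.
    by rewrite nth_block ?(size_adj adjP).
  apply/wp_seq/(@wp_put W K) => //=; first lia.
  apply/wp_seq/(@wp_put W K) => //=; try lia.
  rewrite sI sA mv addn1; apply: (@wp_next_block _ v) => //=.
    by move=> x xK; rewrite -[LHS]/(tab K _ 0 x) !tab_set /=; [exact: m0|lia..].
  split=> //=.
  + by rewrite !cost_addr /=; lia.
  + move=> u; rewrite ltnS leq_eqVlt => /orP[/eqP uk|uk]; rewrite !tab_set //=; try lia.
      by rewrite -uk eqxx; split=> //; congr (deg e); apply: val_inj.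
    by rewrite ltn_eqF //; apply: tab_v.
  + by move=> x xK; rewrite -[LHS]/(tab K _ 0 x) !tab_set /=; [exact: m0|lia..].
- move=> t s fr [le_t sA tab_v m0]; apply: HQ.
  + by rewrite /=; lia.
  + by rewrite fr.
  + by rewrite fr.
  + by split=> // v; have [] := tab_v v (ltn_ord v).
Qed.

Lemma wp_find_max s (Q : nat -> state -> Prop) :
  0 < n -> regs s rN = n -> regs s 1 = K ->
  (forall t s' (r : 'I_n), t <= 200 * n.+1 -> memory s' = memory s -> regs s' rR = r ->
     (forall v : 'I_n, tab K (memory s) 6 v <= tab K (memory s) 6 r) ->
     (forall x, ~~ writes find_max x -> regs s' x = regs s x) -> Q t s') ->
  wp W find_max s Q.
Proof.
move=> n_gt0 sN sK HQ; apply: wp_regs.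
apply/wp_seq/wp_assign => /=; first lia.
apply/wp_seq/wp_assign => /=; first lia.
set s1 := setr _ _ _.
pose I k t s' := exists r : 'I_n, [/\ t <= 100 * k, memory s' = memory s, regs s' rR = r,
  regs s' rB <= tab K (memory s) 6 r
  & forall v : 'I_n, v < k -> tab K (memory s) 6 v <= regs s' rB].
apply: (@wp_for W rI rN _ n I) => //; [lia|lia| | |].
- by exists (Ordinal n_gt0); split.
- move=> k t s2 lt_k s2I fr [r [le_t m2 s2R s2B max_B]].
  have s2K : regs s2 1 = K by rewrite fr.
  have fit6 : fits W s2 (get 6 (Reg rI)) by rewrite fits_get /= s2I s2K; lia.
  have get6 : value s2 (get 6 (Reg rI)) = tab K (memory s) 6 k.
    by rewrite (@value_get K) //= s2I m2.
  have leS (v : 'I_n) b : tab K (memory s) 6 k <= b -> regs s2 rB <= b ->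
      v < k.+1 -> tab K (memory s) 6 v <= b.
    move=> kb Bb; rewrite ltnS leq_eqVlt => /orP[/eqP->//|vk].
    exact: leq_trans (max_B v vk) Bb.
  apply: wp_if => /=; first by rewrite fit6.
  + rewrite get6 subn_gt0 => lt_B.
    apply/wp_seq/wp_assign; rewrite // get6; apply: wp_assign => //=.
    exists (Ordinal lt_k); split=> //=; first by rewrite !cost_get /=; lia.
    by move=> v; apply: leS => //; apply: ltnW.
  + rewrite get6 => /eqP; rewrite subn_eq0 => le_B; apply: wp_skip.
    exists r; split=> //; first by rewrite !cost_get /=; lia.
    by move=> v; apply: leS.
- move=> t s2 fr [r [le_t m2 s2R s2B max_B]] fr2.
  apply: (HQ _ s2 r) => //; first lia.
  by move=> v; apply: leq_trans (max_B v (ltn_ord v)) s2B.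
Qed.

Lemma wp_output s (r : 'I_n) (Q : nat -> state -> Prop) :
  regs s rN = n -> regs s 1 = K -> regs s rR = r ->
  (forall t s', t <= 200 * n.+1 -> memory s' 0 = tab K (memory s) 6 r ->
     (forall v : 'I_n, memory s' v.+1 =
        if v == r then tab K (memory s) 6 r else tab K (memory s) 7 v) -> Q t s') ->
  wp W output s Q.
Proof.
move=> sN sK sR HQ; have rK := ord_K r.
have fit6 s1 : regs s1 1 = K -> regs s1 rR = r -> fits W s1 (get 6 (Reg rR)).
  by move=> s1K s1R; rewrite fits_get /= s1R s1K; lia.
apply/wp_seq/(@wp_put W K) => //=; first exact: fit6.
  by rewrite sR; lia.
rewrite (@value_get K) //= sR; set m1 := set_tab _ _ _ _ _; set s1 := State _ _.
have m1E (v : 'I_n) :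
    tab K m1 7 v = if v == r then tab K (memory s) 6 r else tab K (memory s) 7 v.
  by rewrite tab_set //= (inj_eq val_inj).
apply/wp_seq.
pose I k t s' := [/\ t <= 100 * k, agree adj [:: 0] m1 (memory s')
  & forall v : 'I_n, v < k -> tab K (memory s') 0 v.+1 = tab K m1 7 v].
apply: (@wp_for W rI rN _ n I) => //; [lia|lia| |].
- move=> k t s2 lt_k s2I fr [le_t a2 out].
  have s2K : regs s2 1 = K by rewrite fr.
  apply: (@wp_put W K) => //=; rewrite ?fits_get /= ?s2I ?s2K; try lia.
  rewrite (@value_get K) //= s2I addn1; split=> /=.
  + by rewrite cost_addr cost_get /=; lia.
  + by apply: agree_set => //; lia.
  + move=> v; rewrite ltnS leq_eqVlt => /orP[/eqP->|vk]; rewrite tab_set /=; try lia.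
      by rewrite eqxx a2 //; lia.
    by rewrite eqSS ltn_eqF // out.
- move=> t s2 fr [le_t a2 out].
  have s2K : regs s2 1 = K by rewrite fr.
  have s2R : regs s2 rR = r by rewrite fr.
  apply: (@wp_put W K) => //=; [lia|exact: fit6|lia|].
  rewrite (@value_get K) //= s2R a2 // tab_set //=.
  apply: HQ => /=.
  + by rewrite !cost_addr !cost_get /=; lia.
  + by [].
  + move=> v; have lt_v := ltn_ord v.
    by rewrite -[LHS]/(tab K _ 0 v.+1) tab_set /=; [rewrite out ?m1E|lia..].
Qed.

(** For the upper bound, a partition into [k] parts yields a ranking with [f v = k] for some [v],
    and [ranking_le_message] with [q] equal to [v] gives [k <= M v v]. *)
Lemma output_optimal M (s : state) (r : 'I_n) :
  messages e M -> (forall v, M v v <= M r r) -> memory s 0 = M r r ->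
  memory s r.+1 = M r r ->
  (forall v : 'I_n, 0 < memory s v.+1 <= M r r) ->
  ranking e (fun v : 'I_n => memory s v.+1) ->
  strong_transitive_partition e (output_partition n s) /\
  size (output_partition n s) = strong_transitivity e.
Proof.
move=> ME M_max m0 mr f_le rk; have [e_sym _] := e_simple.
have stP : strong_transitive_partition e (output_partition n s).
  by rewrite /output_partition m0; apply: (ranking_strong_transitive e_sym f_le mr rk).
split=> //; apply/eqP; rewrite eqn_leq strong_transitivity_max //=.
rewrite size_map size_iota m0; apply/bigmax_leqP => k /existsP[P stPk].
have [k0|k_gt0] := posnP k; first by rewrite k0.
have [f [rk_f f_onto]] := strong_transitive_ranking e_sym stPk.
have [|v fv] := f_onto k _ k_gt0; first by rewrite size_tuple.
rewrite -fv; apply: leq_trans (M_max v).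
exact: ranking_le_message ME rk_f _ _ (leqnn _).
Qed.

Lemma wp_program :
  wp W strong_transitivity_program (initial_state (encode_graph adj))
    (fun t s => [/\ t <= 80 * (100 * K),
       strong_transitive_partition e (output_partition n s)
     & size (output_partition n s) = strong_transitivity e]).
Proof.
have [M ME] := messages_exist e; have [n_gt0 _ _] := e_tree; rewrite card_ord in n_gt0.
have [e_sym e_irr] := e_simple.
have sumE : \sum_v (deg e v).+1 = n + \sum_v deg e v.
  under eq_bigr => v _ do rewrite -add1n.
  by rewrite big_split sum1_card card_ord.
have KE := size_encode; set S := \sum_v (deg e v).+1 in KE sumE.
apply/wp_seq/wp_load => t1 s1 le_t1 s1N s1K g1.
apply/wp_seq/wp_assign => /=; first lia.
set s1' := setr _ _ _.
apply/wp_seq/(@wp_bfs _ _ _ _ e_simple e_tree adjP W_large s1' (Ordinal n_gt0)) => //.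
move=> t2 s2 o par le_t2 a2 rt all_o tab2 fr2; rewrite /s1' /= in a2 fr2.
have s2K : regs s2 1 = K by rewrite fr2.
have s2N : regs s2 rN = n by rewrite fr2.
have g2 : graph_tab e adj (memory s2) by apply: agree_graph a2 _ g1.
apply/wp_seq/(@wp_sweep_up _ _ _ _ e_simple e_tree adjP W_large
  _ ME _ _ _ _ _ s2N s2K g2 rt all_o tab2).
move=> t3 s3 le_t3 a3 D3 _ _ fr3; have [tab2o tab2u] := tab2.
have s3K : regs s3 1 = K by rewrite fr3.
have s3N : regs s3 rN = n by rewrite fr3.
have g3 : graph_tab e adj (memory s3) by apply: agree_graph a3 _ g2.
have so : size o = n by have [uo _ _ _] := rt; apply: size_all uo all_o.
apply/wp_seq/(@wp_sweep_down _ _ _ _ e_simple e_tree adjP W_large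
  _ ME _ _ _ _ _ s3N s3K g3 rt all_o) => //.
- by move=> i v lt_i; rewrite a3 ?(tab2o i v) //; lia.
- by move=> v; rewrite a3 //; have [] := tab2u v (all_o v).
move=> t4 s4 le_t4 a4 D4 fr4.
have s4K : regs s4 1 = K by rewrite fr4.
have s4N : regs s4 rN = n by rewrite fr4.
have g4 : graph_tab e adj (memory s4) by apply: agree_graph a4 _ g3.
apply/wp_seq/wp_find_max => // t5 s5 r le_t5 m5 s5R max_r fr5.
have M_max v : M v v <= M r r by have := max_r v; rewrite !D4.
have s5K : regs s5 1 = K by rewrite fr5.
have s5N : regs s5 rN = n by rewrite fr5.
have g5 : graph_tab e adj (memory s5) by rewrite m5.
apply/wp_seq/(@wp_bfs _ _ _ _ e_simple e_tree adjP W_large s5 r) => //.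
move=> t6 s6 o6 par6 le_t6 a6 rt6 all_o6 tab6 fr6.
have s6K : regs s6 1 = K by rewrite fr6.
have s6N : regs s6 rN = n by rewrite fr6.
have g6 : graph_tab e adj (memory s6) by apply: agree_graph a6 _ g5.
apply/wp_seq/(@wp_sweep_up _ _ _ _ e_simple e_tree adjP W_large
  _ ME _ _ _ _ _ s6N s6K g6 rt6 all_o6 tab6).
move=> t7 s7 le_t7 _ D7 F7 slots7 fr7.
have s7K : regs s7 1 = K by rewrite fr7.
have s7N : regs s7 rN = n by rewrite fr7.
have s7R : regs s7 rR = r by rewrite fr7 // fr6.
apply: (wp_output s7N s7K s7R) => t8 s8 le_t8 s8_0 s8_v.
have [_ _ par_r parP] := rt6.
have D7r : tab K (memory s7) 6 r = M r r by rewrite D7 par_r.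
have M_le v : M v (par6 v) <= M v v.
  have [->//|vr] := eqVneq v r; first by rewrite par_r.
  have [_ _ pe] := parP v (all_o6 v) vr; rewrite e_sym in pe.
  by rewrite (message_excl e_irr ME pe (fun=> fun=> erefl)) -ME leq_subr.
have M_gt0 : 0 < M r r by rewrite ME; apply: grank_gt0.
have [||||stP szP] := @output_optimal M s8 r ME M_max.
- by rewrite s8_0.
- by rewrite s8_v eqxx.
- move=> v; rewrite s8_v D7r; case: eqVneq => [_|vr]; first by rewrite M_gt0 leqnn.
  have /andP[-> le_F] := F7 v vr; apply: leq_trans le_F _.
  by have := M_le v; have := M_max v; lia.
(* For [v != r] the part is at most [maxn 1 (M v (par6 v))], and [0 < i] strictly below it forces
   [i < M v (par6 v)]. The dominator found is a child, hence not [r], so its output is its slot from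
   row 7. *)
- move=> v i i_lt.
  have [|w [vw nw dw w7]] := slots7 v i.
    move: i_lt; rewrite s8_v; case: eqVneq => [->|vr]; first by rewrite D7r par_r.
    case/andP=> i_gt0 lt_i; have /andP[_ le_F] := F7 v vr.
    by have := leq_trans lt_i le_F; lia.
  exists w; split=> //; rewrite s8_v ifN //.
  by have [_ wr _] := child e_simple e_tree rt6 all_o6 vw nw.
by split=> //; rewrite /= KE; lia.
Qed.

End Main.

Theorem theorem8 :
  exists (p : cmd) (c : nat),
  forall (n : nat) (e : rel 'I_n) (adj : 'I_n -> seq 'I_n),
    simple_graph e -> tree e -> adjacency_lists e adj ->
    exists (t : nat) (s : state),
      [/\ exec (word_bound c (n + #|edges e|)) p
            (initial_state (encode_graph adj)) t s,
          t <= c * (n + #|edges e|),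
          strong_transitive_partition e (output_partition n s)
        & size (output_partition n s) = strong_transitivity e].
Proof.
(* [wp_program] allows [80 * 100] units per input cell, and there are at most [3 * N] cells. The
   same number, as an exponent, bounds the words. *)
exists strong_transitivity_program, (240 * 100) => n e adj e_simple e_tree adjP.
have [n_gt0 _ _] := e_tree; rewrite card_ord in n_gt0.
set N := n + #|edges e|.
have K_le : size (encode_graph adj) <= 3 * N.
  rewrite (size_encode adjP); under eq_bigr => v _ do rewrite -add1n.
  rewrite big_split sum1_card card_ord /=.
  rewrite -addSn; apply: leq_trans (leq_add (leqnn _) (sum_deg_le e)) _.
  by rewrite /N; lia.
have W_large : 20 * size (encode_graph adj) <= word_bound (240 * 100) N.
  have N1 : 1 < N.+1 by rewrite /N; lia.
  (* The words needed are below [20 * (3 * N) <= 2 ^ 6 * N.+1], and [2 <= N.+1] turns this into the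
     seventh power. *)
  apply: leq_trans (_ : N.+1 ^ 7 <= _); last by rewrite leq_exp2l.
  apply: leq_trans (_ : N.+1 * 2 ^ 6 <= _); first by rewrite [2 ^ 6]/=; lia.
  by rewrite (expnS N.+1 6) leq_mul2l leq_exp2r.
have [t [s [ex [le_t stP szP]]]] := wp_program e_simple e_tree adjP W_large.
by exists t, s; split=> //; apply: leq_trans le_t _; lia.
Qed.
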